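(* Let $m\ge 2$ and let $\{\Pi^n\}_{n\ge1}$ be any sequence of parsimonious protocols with $m$ memory states such that $\lim_{n\to\infty}U^R(\Pi^n)=\sup_\Pi U^R(\Pi)$. Exclude the case in which both $\gamma^{m-2}\le\kappa$ and $p=\tfrac12$. Then $\lim_{n\to\infty}U^S(\Pi^n)$ exists and \[ \lim_{n\to\infty}U^S(\Pi^n)= \begin{cases} p+\dfrac{2p-1}{\gamma^{m-2}-1}, & \text{if } \gamma^{m-2}>\kappa,\\[0.6em] 1, & \text{if } \gamma^{m-2}\le\kappa \text{ and } p>\tfrac12,\\[0.3em] 0, & \text{if } \gamma^{m-2}\le\kappa \text{ and } p<\tfrac12. \end{cases} \]
   Context: Setting. The state of nature is $\theta\in\Theta=\{H,L\}$ with prior $\Pr(\theta=H)=p\in(0,1)$. A sender privately observes $\theta$; a receiver does not. $S$ is a finite signal set; conditional on $\theta$, signals are i.i.d. with distribution $\pi_\theta$ on $S$, where $\pi_\theta(s)>0$ for all $s\in S,\theta\in\Theta$, and $\pi_H\neq\pi_L$. The receiver has the set of memory states $M=\{1,\dots,m\}$ and chooses a protocol $\Pi=(f,g,a)$: a transition function $f:M\times S\to\Delta(M)$ ($f(i,s)(j)$ is the probability of moving from memory state $i$ to $j$ after signal $s$), an initial distribution $g\in\Delta(M)$ of $m_0$, and an action rule $a:M\to[0,1]$ (probability of action $H$ if the game ends in that memory state). A sender strategy is $\sigma:M\times\Theta\to[0,1]$, the probability of stopping in the current memory state given $\theta$. Timing: $m_0\sim g$; in each period $t=0,1,\dots$,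 with current memory state $m_t$, the game ends if $m_t$ is absorbing ($f(m_t,s)(m_t)=1$ for all $s$); otherwise the sender stops with probability $\sigma(m_t,\theta)$, ending the game; if not stopped, a signal $s_t\sim\pi_\theta$ is generated and $m_{t+1}\sim f(m_t,s_t)$. When the game ends in state $m_t$ the receiver takes action $H$ with probability $a(m_t)$ and $L$ otherwise. The receiver's payoff is $1$ if the action equals $\theta$ and $0$ otherwise; the sender's payoff is $1$ if the action is $H$ and $0$ otherwise; there is no discounting; if the game never ends both get $0$. $U^S(\Pi,\sigma),U^R(\Pi,\sigma)$ denote expected payoffs, $\mathrm{br}(\Pi)=\arg\sup_\sigma U^S(\Pi,\sigma)$ is the set of sender best responses, and $U^R(\Pi):=U^R(\Pi,\sigma)$, $U^S(\Pi):=U^S(\Pi,\sigma)$ for $\sigma\in\mathrm{br}(\Pi)$. The supremum $\sup_\Pi$ is over all protocols on $M$. Since $\pi_\theta$ has full support, which transitions have positive probability does not depend on $\theta$; absorbing/transient refer to the Markov chain on $M$ induced by $f$ with signals from $\pi_\theta$. A protocol is parsimonious if (i) it has exactly two absorbing memory states, one in which $a=0$ and one in which $a=1$, and (ii) all other memory states are transient with $a=0$. Signal informativeness: $\bar\ell=\max_{s}\pi_H(s)/\pi_L(s)$, $\underline\ell=\min_{s}\pi_H(s)/\pi_L(s)$, $\gamma=\bar\ell/\underline\ell\in(1,\infty)$. Prior skewness: $\kappa=\max\{p/(1-p),(1-p)/p\}$. *)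

(* Defs.v *)
From HB Require Import structures.
From mathcomp Require Import all_boot all_order all_algebra.
From mathcomp Require Import all_classical all_reals all_analysis.
Set Implicit Arguments. Unset Strict Implicit. Unset Printing Implicit Defensive.
Import Order.TTheory GRing.Theory Num.Theory.
Import numFieldNormedType.Exports.
Local Open Scope classical_set_scope.
Local Open Scope ring_scope.

Section Game.
Variables (R : realType) (S : finType) (m : nat).

(* Memory states M = 'I_m; theta = true means H, false means L. *)
Record protocol := Protocol {
  pf : 'I_m -> S -> 'I_m -> R;
  pg : 'I_m -> R;               (* initial distribution g *)
  pa : 'I_m -> R                (* probability of action H *)
}.

Definition is_distr (T : finType) (d : T -> R) :=
  (forall x, 0 <= d x) /\ \sum_x d x = 1.

Definition valid_protocol (P : protocol) :=
  [/\ (forall i s, is_distr (pf P i s)), is_distr (pg P)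
    & (forall i, 0 <= pa P i <= 1)].

(* sender strategy sigma(i, theta) = probability of stopping *)
Definition strategy := 'I_m -> bool -> R.
Definition valid_strategy (sg : strategy) := forall i th, 0 <= sg i th <= 1.

Definition absorbing (P : protocol) (i : 'I_m) : bool :=
  [forall s, pf P i s i == 1].

Variables (piH piL : S -> R) (p : R).

Definition sigprob (th : bool) := if th then piH else piL.

Definition trans_prob (P : protocol) th (i j : 'I_m) :=
  \sum_s sigprob th s * pf P i s j.

(* taboo probabilities: started at i, at state j at time t, without
   having visited i at times 1..t *)
Fixpoint taboo (P : protocol) th (i : 'I_m) (t : nat) : 'I_m -> R :=
  match t with
  | 0 => fun j => (j == i)%:R
  | t'.+1 => fun j => if j == i then 0
                      else \sum_k taboo P th i t' k * trans_prob P th k j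
  end.

Definition return_prob (P : protocol) th (i : 'I_m) :=
  limn (fun n => \sum_(t < n) \sum_k taboo P th i t k * trans_prob P th k i).

Definition transient (P : protocol) (i : 'I_m) := forall th, return_prob P th i < 1.

Definition parsimonious (P : protocol) :=
  exists i0 i1 : 'I_m,
    [/\ i0 != i1, absorbing P i0 && absorbing P i1, pa P i0 = 0 /\ pa P i1 = 1,
        (forall j, absorbing P j -> j = i0 \/ j = i1)
      & (forall j, j != i0 -> j != i1 -> transient P j /\ pa P j = 0)].

Definition stop_prob (P : protocol) (sg : strategy) th (i : 'I_m) :=
  if absorbing P i then 1 else sg i th.

(* probability that the game has not ended before period t and m_t = j *)
Fixpoint alive (P : protocol) (sg : strategy) th (t : nat) : 'I_m -> R :=
  match t with
  | 0 => pg P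
  | t'.+1 => fun j => \sum_i alive P sg th t' i * (1 - stop_prob P sg th i)
                              * trans_prob P th i j
  end.

Definition end_prob (P : protocol) (sg : strategy) th (i : 'I_m) :=
  limn (fun n => \sum_(t < n) alive P sg th t i * stop_prob P sg th i).

Definition prior (th : bool) := if th then p else 1 - p.

Definition US (P : protocol) (sg : strategy) :=
  \sum_(th : bool) prior th * \sum_i end_prob P sg th i * pa P i.

Definition UR (P : protocol) (sg : strategy) :=
  \sum_(th : bool) prior th *
     \sum_i end_prob P sg th i * (if th then pa P i else 1 - pa P i).

Definition US_val (P : protocol) := sup [set US P sg | sg in valid_strategy].

Definition br (P : protocol) :=
  [set sg | valid_strategy sg /\ US P sg = US_val P].

(* U^R(Pi): receiver payoff under a sender best response
   (ties, if any, broken in favor of the receiver) *)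
Definition UR_val (P : protocol) := sup [set UR P sg | sg in br P].

Definition UR_sup := sup [set UR_val P | P in valid_protocol].

Definition lbar := sup (range (fun s => piH s / piL s)).
Definition lunder := inf (range (fun s => piH s / piL s)).
Definition gamma := lbar / lunder.
Definition kappa := Num.max (p / (1 - p)) ((1 - p) / p).

End Game.

(* Main.v *)
(** Let x and y be the probabilities that a parsimonious protocol is absorbed in
    the state with a = 1 given H, resp. given L.  Never stopping is a best
    response, and every best response reaches the state a = 1 with the same
    probabilities x and y, so the sender gets p x + (1 - p) y and the receiver gets
    p x + (1 - p) (1 - y).

    The odds ratio of x and y is at most gamma^(m - 2): pass from the chain of L
    to the chain of H by changing the transitions out of one transient state at a
    time; each change multiplies the odds of absorption by at most gamma.

    The bound is approached as follows.  Start in state 1.  The most H-favourable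
    signal moves one state up, with a small probability delta from the states
    k >= 2; the most L-favourable signal sends the states k >= 2 back to 1, and
    sends 1 to the bottom with a probability of order delta^(m - 3).  The odds of
    absorption at the top then tend to a constant times the (m - 2)-nd power of
    the ratio of the probabilities of the two signals, and the constant can be
    chosen freely.

    Hence sup U^R is at least the maximum of p x + (1 - p) (1 - y) under the odds
    constraint, so the points (x, y) of the given protocols approach the
    constrained maximum, which is unique outside the excluded case. *)
Require Import Defs.
From HB Require Import structures.
From mathcomp Require Import all_boot all_order all_algebra.
From mathcomp Require Import all_classical all_reals all_analysis.
From mathcomp Require Import ring lra zify.
Import Order.TTheory GRing.Theory Num.Theory.
Import numFieldNormedType.Exports.
Set Implicit Arguments.
Unset Strict Implicit.
Unset Printing Implicit Defensive.
Local Open Scope classical_set_scope.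
Local Open Scope ring_scope.

(** * Finite Markov chains with two absorbing states *)

Section Chain.
Variables (R : realType) (m : nat).
Implicit Types (K : 'I_m -> 'I_m -> R) (A C : pred 'I_m) (h u : 'I_m -> R).

Definition stochastic K := forall i, is_distr (K i).

(* No nonempty closed set of states avoids [A]; equivalently, [A] is reached almost
   surely from every state. *)
Definition reaches K A := forall C, (exists i, C i) ->
  (forall i, C i -> ~~ A i) -> exists i j, [/\ C i, ~~ C j & 0 < K i j].

Lemma reaches_sub K A A' : reaches K A -> {subset A <= A'} -> reaches K A'.
Proof.
move=> rK AA' C C0 CA'; apply: rK => // i /CA'; apply: contra => /AA'; exact.
Qed.

(** A positive maximum is attained only off [A], so [reaches] yields a transition out of the set of
    maximisers; at its source the average of [h] is strictly below the maximum. *)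
Lemma maximum_principle K A h : stochastic K -> reaches K A ->
  (forall i, ~~ A i -> h i <= \sum_j K i j * h j) ->
  (forall i, A i -> h i <= 0) -> forall i, h i <= 0.
Proof.
move=> sK rK sub hA i0; rewrite leNgt; apply/negP => h0.
pose k := [arg max_(i > i0) h i]%O.
have kmax i : h i <= h k by rewrite /k; case: arg_maxP => // j _; apply.
have hk : 0 < h k by rewrite (lt_le_trans h0).
have [|i iC|i [j [/eqP iC jC Kij]]] := rK (fun i => h i == h k).
- by exists k.
- by apply/negP => /hA; rewrite (eqP iC) leNgt hk.
have iA : ~~ A i by apply/negP => /hA; rewrite iC leNgt hk.
have [K0 K1] := sK i.
have : 0 < \sum_j K i j * (h k - h j).
  rewrite (bigD1 j) //= ltr_wpDr //.
    by apply: sumr_ge0 => l _; rewrite mulr_ge0 ?subr_ge0.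
  by rewrite mulr_gt0 // subr_gt0 lt_neqAle jC kmax.
under eq_bigr do rewrite mulrBr.
rewrite sumrB -mulr_suml K1 mul1r subr_gt0 ltNge -iC.
by rewrite sub.
Qed.

Lemma minimum_principle K A h : stochastic K -> reaches K A ->
  (forall i, ~~ A i -> \sum_j K i j * h j <= h i) ->
  (forall i, A i -> 0 <= h i) -> forall i, 0 <= h i.
Proof.
move=> sK rK sup hA i; rewrite -oppr_le0.
apply: (@maximum_principle K A (fun j => - h j)) => // j Aj.
  under eq_bigr do rewrite mulrN.
  by rewrite sumrN lerN2 sup.
by rewrite oppr_le0 hA.
Qed.

Lemma harmonic_unique K A h u : stochastic K -> reaches K A ->
  (forall i, ~~ A i -> h i = \sum_j K i j * h j) ->
  (forall i, ~~ A i -> u i = \sum_j K i j * u j) ->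
  (forall i, A i -> h i = u i) -> h =1 u.
Proof.
move=> sK rK hh uu hu.
have aux (f g : 'I_m -> R) : (forall i, ~~ A i -> f i = \sum_j K i j * f j) ->
    (forall i, ~~ A i -> g i = \sum_j K i j * g j) ->
    (forall i, A i -> f i = g i) -> forall i, f i <= g i.
  move=> ff gg fg i; rewrite -subr_ge0.
  apply: (@minimum_principle K A (fun i => g i - f i)) => // j Aj.
    under eq_bigr do rewrite mulrBr.
    by rewrite sumrB -ff // -gg.
  by rewrite fg // subrr.
move=> i; apply/eqP; rewrite eq_le !aux // => j /hu //.
Qed.

(** [h] is the boundary value on [A] and the source term off [A], so one matrix inversion covers
    harmonic extensions and exit times. The square system is invertible because [harmonic_unique]
    makes its kernel trivial. *)
Lemma poisson_solution K A h : stochastic K -> reaches K A ->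
  exists u, (forall i, A i -> u i = h i) /\
    (forall i, ~~ A i -> u i = h i + \sum_j K i j * u j).
Proof.
move=> sK rK.
pose N := \matrix_(i, j) ((i == j)%:R - (~~ A i)%:R * K i j) : 'M[R]_m.
have NE (v : 'cV[R]_m) i : (N *m v) i 0 = v i 0 - (~~ A i)%:R * \sum_j K i j * v j 0.
  rewrite mxE; under eq_bigr do rewrite mxE mulrBl -mulrA.
  rewrite sumrB -mulr_sumr (bigD1 i) //= eqxx mul1r big1 ?addr0 // => j.
  by rewrite eq_sym => /negPf->; rewrite mul0r.
have Nu : N \in unitmx.
  rewrite -unitmx_tr -row_free_unit -kermx_eq0; apply/rowV0P => v /sub_kermxP vN.
  have Nv : N *m v^T = 0 by rewrite -[N]trmxK -trmx_mul vN trmx0.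
  have v0 : (fun i => v^T i 0) =1 (fun=> 0).
    apply: (harmonic_unique sK rK) => i Ai.
    - have := NE v^T i; rewrite Nv mxE Ai mul1r => /eqP.
      by rewrite eq_sym subr_eq0 => /eqP.
    - by rewrite big1 // => j _; rewrite mulr0.
    - by have := NE v^T i; rewrite Nv mxE Ai mul0r subr0.
  by apply/rowP => i; have := v0 i; rewrite !mxE.
pose u := invmx N *m \col_i h i.
have Nuu : N *m u = \col_i h i by rewrite mulKVmx.
exists (fun i => u i 0); split => i Ai; have := NE u i; rewrite Nuu mxE.
  by rewrite Ai mul0r subr0.
by rewrite Ai mul1r => ->; rewrite subrK.
Qed.

Lemma harmonic_extension K A h : stochastic K -> reaches K A ->
  (forall i, A i -> 0 <= h i) ->
  exists u, [/\ forall i, A i -> u i = h i,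
    forall i, ~~ A i -> u i = \sum_j K i j * u j & forall i, 0 <= u i].
Proof.
move=> sK rK hA.
have [u [uA uK]] := @poisson_solution K A (fun i => (A i)%:R * h i) sK rK.
have uA' i : A i -> u i = h i by move=> Ai; rewrite uA // Ai mul1r.
have uK' i : ~~ A i -> u i = \sum_j K i j * u j.
  by move=> Ai; rewrite uK // (negPf Ai) mul0r add0r.
exists u; split=> //.
apply: (@minimum_principle K A) => // i Ai; first by rewrite -uK'.
by rewrite uA' // hA.
Qed.

(* [w] is the expected time before [A] is reached. *)
Lemma exit_time K A : stochastic K -> reaches K A ->
  exists w, [/\ forall i, A i -> w i = 0,
    forall i, ~~ A i -> \sum_j K i j * w j = w i - 1 & forall i, 0 <= w i].
Proof.
move=> sK rK.
have [w [wA wK]] := @poisson_solution K A (fun i => (~~ A i)%:R) sK rK.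
have wA' i : A i -> w i = 0 by move=> Ai; rewrite wA // Ai.
have wK' i : ~~ A i -> \sum_j K i j * w j = w i - 1.
  by move=> Ai; rewrite (wK i) // Ai addrAC subrr add0r.
exists w; split => //; apply: (@minimum_principle K A) => // i Ai.
  by rewrite wK' // lerBlDr lerDl ler01.
by rewrite wA'.
Qed.

(** * Odds of absorption under a change of kernel *)

Section Odds.
Variables (i0 i1 : 'I_m) (g : 'I_m -> R).
Hypotheses (i01 : i0 != i1) (dg : is_distr g).

(** The probability of absorption at [i1], as a function of the starting state, is described by its
    Dirichlet problem rather than by a measure on paths. *)
Definition hitting K h := [/\ h i0 = 0, h i1 = 1 &
  forall i, ~~ pred2 i0 i1 i -> h i = \sum_j K i j * h j].

Lemma hitting_exists K : stochastic K -> reaches K (pred2 i0 i1) ->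
  exists h, hitting K h.
Proof.
move=> sK rK.
have [|h [hA hK _]] := @harmonic_extension K (pred2 i0 i1) (fun i => (i == i1)%:R) sK rK.
  by move=> i _; rewrite ler0n.
exists h; split => //.
  by rewrite hA /= ?eqxx // (negPf i01).
by rewrite hA /= ?eqxx ?orbT.
Qed.

Lemma hitting_ge0 K h : stochastic K -> reaches K (pred2 i0 i1) ->
  hitting K h -> forall i, 0 <= h i.
Proof.
move=> sK rK [h0 h1 hK]; apply: (minimum_principle sK rK) => i Ai.
  by rewrite -hK.
by case/orP: Ai => /eqP->; rewrite ?h0 ?h1.
Qed.

Lemma hitting_le1 K h : stochastic K -> reaches K (pred2 i0 i1) ->
  hitting K h -> forall i, h i <= 1.
Proof.
move=> sK rK [h0 h1 hK] i; rewrite -subr_le0.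
apply: (@maximum_principle K (pred2 i0 i1) (fun i => h i - 1)) => // j Aj.
  have [_ K1] := sK j.
  under eq_bigr do rewrite mulrBr mulr1.
  by rewrite sumrB K1 -hK.
by case/orP: Aj => /eqP->; rewrite ?h0 ?h1 ?subrr // sub0r oppr_le0 ler01.
Qed.

Lemma distr_ge0 h : (forall i, 0 <= h i) -> 0 <= \sum_i g i * h i.
Proof. by move=> h0; apply: sumr_ge0 => i _; rewrite mulr_ge0 // dg.1. Qed.

Lemma distr_le1 h : (forall i, h i <= 1) -> \sum_i g i * h i <= 1.
Proof.
by move=> h1; rewrite -dg.2; apply: ler_sum => i _; rewrite ler_piMr // dg.1.
Qed.

(* The path is decomposed at its visits to [k], the only state whose
   transitions change: [b1] and [b0] are the probabilities of reaching [i1],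
   resp. [i0], before [k]; the odds of absorption at [i1] are a ratio of two
   linear forms in row [k] with nonnegative coefficients. *)
Lemma odds_change_row K K' h h' k (lo hi : R) :
  stochastic K -> stochastic K' ->
  reaches K (pred2 i0 i1) -> reaches K' (pred2 i0 i1) ->
  hitting K h -> hitting K' h' ->
  ~~ pred2 i0 i1 k -> 0 < lo ->
  (forall i j, i != k -> K' i j = K i j) ->
  (forall j, lo * K k j <= K' k j <= hi * K k j) ->
  lo * (\sum_i g i * h' i) * (1 - \sum_i g i * h i) <=
  hi * (1 - \sum_i g i * h' i) * (\sum_i g i * h i).
Proof.
move=> sK sK' rK rK' hh hh' kA lo0 KK' Klohi.
pose A := [predU1 k & pred2 i0 i1].
have rA : reaches K A.
  by apply: reaches_sub rK _ => i; rewrite !inE => ->; rewrite orbT.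
have [k0 k1] : k != i0 /\ k != i1 by move: kA => /=; rewrite negb_or => /andP[].
have AE i : ~~ A i -> i != k /\ ~~ pred2 i0 i1 i.
  by rewrite /A /= negb_or => /andP[].
have [|b1 [b1A b1K b1p]] := @harmonic_extension K A (fun i => (i == i1)%:R) sK rA.
  by move=> i _; rewrite ler0n.
have [|b0 [b0A b0K b0p]] := @harmonic_extension K A (fun i => (i == i0)%:R) sK rA.
  by move=> i _; rewrite ler0n.
(* [bk] is the probability of visiting [k] before absorption. *)
pose bk i := 1 - b0 i - b1 i.
have Ai0 : A i0 by rewrite /A /= !inE eqxx orbT.
have Ai1 : A i1 by rewrite /A /= !inE eqxx !orbT.
have Ak : A k by rewrite /A /= eqxx.
have bkk : bk k = 1 by rewrite /bk b0A // b1A // (negPf k0) (negPf k1) !subr0.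
have bk0 : bk i0 = 0 by rewrite /bk b0A // b1A // eqxx (negPf i01) subr0 subrr.
have bk1 : bk i1 = 0.
  by rewrite /bk b0A // b1A // eqxx eq_sym (negPf i01) subr0 subrr.
have sumbk i : \sum_j K i j * bk j = 1 - \sum_j K i j * b0 j - \sum_j K i j * b1 j.
  under eq_bigr do rewrite /bk !mulrBr mulr1.
  by rewrite !sumrB (sK i).2.
have bkK i : ~~ A i -> bk i = \sum_j K i j * bk j.
  by move=> Ai; rewrite sumbk -b0K // -b1K.
have bkp : forall i, 0 <= bk i.
  apply: (minimum_principle sK rA) => i Ai; first by rewrite -bkK.
  case/or3P: Ai => /eqP->; by rewrite ?bkk ?bk0 ?bk1.
(* Decomposition at the first visit to [k]: both kernels agree off [k], so [b1] and [bk] serve both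
   and only [f k] depends on the kernel. *)
have dec L f : stochastic L -> hitting L f -> (forall i j, i != k -> L i j = K i j) ->
    f =1 (fun i => b1 i + f k * bk i).
  move=> sL [f0 f1 fL] LK; apply: (harmonic_unique sK rA) => i Ai.
  - have [ik iA] := AE _ Ai; rewrite fL //; apply: eq_bigr => j _.
    by rewrite LK.
  - under eq_bigr do rewrite mulrDr mulrCA.
    by rewrite big_split /= -mulr_sumr -b1K // -bkK.
  - case/or3P: Ai => /eqP->; rewrite ?bkk ?bk0 ?bk1 ?mulr0 ?mulr1 ?addr0 b1A //.
    + by rewrite (negPf k1) add0r.
    + by rewrite (negPf i01).
    + by rewrite eqxx.
pose u1 := \sum_j K k j * b1 j. pose u0 := \sum_j K k j * b0 j.
pose v1 := \sum_j K' k j * b1 j. pose v0 := \sum_j K' k j * b0 j.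
have kEq L f : stochastic L -> hitting L f -> f =1 (fun i => b1 i + f k * bk i) ->
    f k * (\sum_j L k j * b1 j + \sum_j L k j * b0 j) = \sum_j L k j * b1 j.
  move=> sL [_ _ fL] fE.
  have : f k = \sum_j L k j * b1 j +
      f k * (1 - \sum_j L k j * b0 j - \sum_j L k j * b1 j).
    rewrite {1}fL // -(sL k).2 -!sumrB mulr_sumr -big_split /=.
    by apply: eq_bigr => j _; rewrite [in LHS]fE /bk mulrDr mulrCA !mulrBr mulr1.
  by rewrite mulrDr !mulrBr mulr1; lra.
have u1p : 0 <= u1 by apply: sumr_ge0 => j _; rewrite mulr_ge0 // (sK k).1.
have u0p : 0 <= u0 by apply: sumr_ge0 => j _; rewrite mulr_ge0 // (sK k).1.
have lov b : (forall i, 0 <= b i) -> lo * (\sum_j K k j * b j) <= \sum_j K' k j * b j.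
  move=> bp; rewrite mulr_sumr; apply: ler_sum => j _; rewrite mulrA ler_wpM2r //.
  by case/andP: (Klohi j).
have hiv b : (forall i, 0 <= b i) -> \sum_j K' k j * b j <= hi * (\sum_j K k j * b j).
  move=> bp; rewrite mulr_sumr; apply: ler_sum => j _; rewrite mulrA ler_wpM2r //.
  by case/andP: (Klohi j).
(* Otherwise [bk] would be harmonic at [k] too, with zero boundary values, hence identically zero,
   although [bk k = 1]. *)
have u_gt0 : 0 < u1 + u0.
  rewrite lt_neqAle addr_ge0 // andbT; apply/eqP => u00.
  suff /(_ k) : bk =1 (fun=> 0) by rewrite bkk => /eqP; rewrite oner_eq0.
  apply: (harmonic_unique sK rK) => i Ai.
  - have [->|ik] := eqVneq i k.
      rewrite sumbk bkk -/u1 -/u0; lra.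
    by rewrite bkK // /A /= negb_or ik.
  - by rewrite big1 // => j _; rewrite mulr0.
  - by case/orP: Ai => /eqP->.
have v_gt0 : 0 < v1 + v0.
  apply: lt_le_trans (lerD (lov _ b1p) (lov _ b0p)).
  by rewrite -mulrDr mulr_gt0.
have hE := dec _ _ sK hh (fun _ _ _ => erefl).
have h'E := dec _ _ sK' hh' KK'.
have ck := kEq _ _ sK hh hE; have ck' := kEq _ _ sK' hh' h'E.
rewrite -/u1 -/u0 in ck; rewrite -/v1 -/v0 in ck'.
pose a1 := \sum_i g i * b1 i; pose ak := \sum_i g i * bk i.
pose a0 := \sum_i g i * b0 i.
have a1p : 0 <= a1 by apply: distr_ge0.
have akp : 0 <= ak by apply: distr_ge0.
have a0p : 0 <= a0 by apply: distr_ge0.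
have asum : a0 = 1 - a1 - ak.
  rewrite -dg.2 /a1 /ak /a0 -!sumrB; apply: eq_bigr => j _; rewrite /bk; ring.
have xE f : f =1 (fun i => b1 i + f k * bk i) ->
    \sum_i g i * f i = a1 + f k * ak.
  move=> fE; rewrite mulr_sumr -big_split /=; apply: eq_bigr => i _.
  rewrite [in LHS]fE; ring.
rewrite (xE _ hE) (xE _ h'E).
have := hiv _ b1p; have := hiv _ b0p; have := lov _ b1p; have := lov _ b0p.
rewrite -/u1 -/u0 -/v1 -/v0 => l0 l1 H0 H1.
set c := h k in ck *; set c' := h' k in ck' *.
(* Clearing the denominators leaves products of nonnegative linear forms in [u1], [u0] and [v1],
   [v0], which compare factor by factor through [lo] and [hi]. *)
rewrite -(ler_pM2r u_gt0) -(ler_pM2r v_gt0).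
have X'E : (a1 + c' * ak) * (v1 + v0) = (a1 + ak) * v1 + a1 * v0.
  by rewrite mulrDl mulrAC ck'; ring.
have XE : (a1 + c * ak) * (u1 + u0) = (a1 + ak) * u1 + a1 * u0.
  by rewrite mulrDl mulrAC ck; ring.
have Y'E : (1 - (a1 + c' * ak)) * (v1 + v0) = a0 * v1 + (a0 + ak) * v0.
  by rewrite mulrBl X'E asum; ring.
have YE : (1 - (a1 + c * ak)) * (u1 + u0) = a0 * u1 + (a0 + ak) * u0.
  by rewrite mulrBl XE asum; ring.
rewrite [leLHS](_ : _ = ((a1 + c' * ak) * (v1 + v0)) *
    (lo * ((1 - (a1 + c * ak)) * (u1 + u0)))); last by ring.
rewrite [leRHS](_ : _ = (hi * ((a1 + c * ak) * (u1 + u0))) *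
    ((1 - (a1 + c' * ak)) * (v1 + v0))); last by ring.
rewrite X'E XE YE Y'E.
have v1p : 0 <= v1 by apply: le_trans l1; rewrite mulr_ge0 // ltW.
have v0p : 0 <= v0 by apply: le_trans l0; rewrite mulr_ge0 // ltW.
apply: ler_pM.
- by rewrite addr_ge0 // mulr_ge0 // addr_ge0.
- by rewrite mulr_ge0 ?(ltW lo0) // addr_ge0 // mulr_ge0 // addr_ge0.
- rewrite mulrDr !mulrA ![hi * _]mulrC -!mulrA.
  by rewrite lerD // ler_wpM2l ?addr_ge0.
- rewrite mulrDr !mulrA ![lo * _]mulrC -!mulrA.
  by rewrite lerD // ler_wpM2l ?addr_ge0.
Qed.

End Odds.
End Chain.

(** The hybrid kernel [hyb s] takes its rows from [K'] on [s] and from [K] elsewhere. Adding one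
    state to [s] multiplies the odds by at most [hi / lo], and [m - 2] states lie outside [i0] and
    [i1]. *)
Lemma odds_change (R : realType) (m : nat) (i0 i1 : 'I_m) (g : 'I_m -> R)
    (K K' : 'I_m -> 'I_m -> R) (h h' : 'I_m -> R) (lo hi : R) :
  i0 != i1 -> is_distr g -> stochastic K -> stochastic K' ->
  reaches K (pred2 i0 i1) -> hitting i0 i1 K h -> hitting i0 i1 K' h' ->
  0 < lo -> (forall i j, lo * K i j <= K' i j <= hi * K i j) ->
  lo ^+ (m - 2) * (\sum_i g i * h' i) * (1 - \sum_i g i * h i) <=
  hi ^+ (m - 2) * (1 - \sum_i g i * h' i) * (\sum_i g i * h i).
Proof.
move=> i01 dg sK sK' rK hh hh' lo0 lohi.
pose A := pred2 i0 i1.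
pose hyb (s : seq 'I_m) i j := if i \in s then K' i j else K i j.
have shyb s : stochastic (hyb s).
  by move=> i; rewrite /hyb; case: (i \in s); [exact: sK' | exact: sK].
have rhyb s : reaches (hyb s) A.
  move=> C C0 CA; have [i [j [Ci Cj Kij]]] := rK C C0 CA.
  exists i, j; split=> //; rewrite /hyb; case: ifP => // _.
  by have /andP[lK _] := lohi i j; apply: lt_le_trans lK; exact: mulr_gt0.
have hi0 : 0 < hi.
  have : 0 < \sum_j hi * K i0 j.
    apply: (@lt_le_trans _ _ (lo * \sum_j K i0 j)).
      by rewrite (sK i0).2 mulr1.
    rewrite mulr_sumr; apply: ler_sum => j _.
    by case/andP: (lohi i0 j); apply: le_trans.
  by rewrite -mulr_sumr (sK i0).2 mulr1.
set x := \sum_i g i * h i.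
have x1 : x <= 1 by apply/distr_le1/(hitting_le1 sK rK hh).
suff main s f : uniq s -> all (predC A) s -> hitting i0 i1 (hyb s) f ->
    lo ^+ size s * (\sum_i g i * f i) * (1 - x) <=
    hi ^+ size s * (1 - \sum_i g i * f i) * x.
  have <- : size (enum (predC A)) = (m - 2)%N.
    rewrite -cardE; have := cardC A; rewrite card_ord card2 i01 => E.
    by apply/esym; rewrite -[X in (X - _)%N]E addKn.
  apply: main; first exact: enum_uniq.
    by apply/allP => i; rewrite mem_enum.
  case: hh' => h0 h1 hK; split=> // i iA; rewrite hK //.
  by apply: eq_bigr => j _; rewrite /hyb mem_enum [_ \in _]iA.
elim: s f => [|k s IH] f.
  move=> _ _ hf; suff -> : \sum_i g i * f i = x by rewrite mulrAC.
  apply: eq_bigr => i _; congr (_ * _).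
  case: hf => f0 f1 fK; case: hh => h0 h1 hK.
  apply: (harmonic_unique sK rK) => // j /orP[] /eqP->; congruence.
move=> /= /andP[ks us] /andP[kA sA] hf.
have [f' hf'] := hitting_exists i01 (shyb s) (rhyb s).
have {IH} := IH f' us sA hf'.
have rowE i j : i != k -> hyb (k :: s) i j = hyb s i j.
  by rewrite /hyb inE => /negPf->.
have rowk j : lo * hyb s k j <= hyb (k :: s) k j <= hi * hyb s k j.
  by rewrite /hyb inE eqxx (negPf ks).
have := odds_change_row i01 dg (shyb s) (shyb (k :: s)) (rhyb s)
  (rhyb (k :: s)) hf' hf kA lo0 rowE rowk.
have fp := distr_ge0 dg (hitting_ge0 (shyb (k :: s)) (rhyb _) hf).
have fl := distr_le1 dg (hitting_le1 (shyb (k :: s)) (rhyb _) hf).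
have f'p := distr_ge0 dg (hitting_ge0 (shyb s) (rhyb _) hf').
have f'l := distr_le1 dg (hitting_le1 (shyb s) (rhyb _) hf').
have xp : 0 <= x := distr_ge0 dg (hitting_ge0 sK rK hh).
move: fp fl f'p f'l; set z := \sum_i g i * f i; set y := \sum_i g i * f' i.
move=> z0 z1 y0 y1 H1 H2.
set a := lo ^+ _ in H2; set b := hi ^+ _ in H2.
have a0 : 0 < a by rewrite exprn_gt0.
have b0 : 0 < b by rewrite exprn_gt0.
rewrite !exprS -/a -/b.
(* Chaining the two inequalities cancels [y * (1 - y)], so the degenerate values of [y] are treated
   first. *)
have [yE|yn0] := eqVneq y 0.
  rewrite yE subr0 mulr1 mulr0 in H1.
  have -> : z = 0.
    by apply/eqP; rewrite eq_le z0 andbT -(ler_pM2l lo0) mulr0.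
  by rewrite mulr0 mul0r mulr_ge0 // mulr_ge0 ?subr0 ?ler01 // mulr_ge0 // ltW.
have [yE|yn1] := eqVneq y 1.
  rewrite yE subrr mulr0 mul0r mulr1 in H2.
  have -> : x = 1.
    apply/eqP; rewrite eq_le x1 /= -subr_le0 -(ler_pM2l a0) mulr0 //.
  rewrite subrr mulr0 mulr1 mulr_ge0 ?subr_ge0 // mulr_ge0 // ltW //.
have yy : 0 < y * (1 - y).
  by rewrite mulr_gt0 ?subr_gt0 // lt_neqAle ?y0 ?y1 ?yn1 // eq_sym yn0.
rewrite -(ler_pM2r yy).
rewrite [leLHS](_ : _ = (lo * z * (1 - y)) * (a * y * (1 - x))); last by ring.
rewrite [leRHS](_ : _ = (hi * (1 - z) * y) * (b * (1 - y) * x)); last by ring.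
apply: ler_pM => //.
  by rewrite mulr_ge0 ?subr_ge0 // mulr_ge0 // ltW.
by rewrite mulr_ge0 ?subr_ge0 // mulr_ge0 // ltW.
Qed.

(** [F] is nonincreasing and bounded below, hence convergent, and [T] is its sequence of
    decrements. *)
Lemma lyapunov_cvg0 (R : realType) (T F : nat -> R) :
  (forall t, 0 <= T t) -> (forall t, 0 <= F t) ->
  (forall t, F t.+1 = F t - T t) -> T @ \oo --> 0.
Proof.
move=> T0 F0 FT.
have cF : cvgn F.
  apply: nonincreasing_is_cvgn.
    by apply/nonincreasing_seqP => t; rewrite FT gerBl.
  by exists 0 => _ [t _ <-].
have -> : T = (fun t => F t - F t.+1).
  by apply/funext => t; rewrite FT opprB addrC subrK.
rewrite -(subrr (limn F)); apply: cvgB => //.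
by rewrite cvg_shiftS.
Qed.

(** * Transience and almost sure absorption *)

Section Protocol.
Variables (R : realType) (S : finType) (m : nat) (piH piL : S -> R).
Hypotheses (pH0 : forall s, 0 < piH s) (pL0 : forall s, 0 < piL s).
Hypotheses (pH1 : \sum_s piH s = 1) (pL1 : \sum_s piL s = 1).
Variable P : protocol R S m.
Hypothesis vP : valid_protocol P.
Implicit Types (th : bool) (i j : 'I_m).

Local Notation K := (trans_prob piH piL P).

Lemma trans_stochastic th : stochastic (K th).
Proof.
have s0 s : 0 <= sigprob piH piL th s by rewrite /sigprob; case: th; rewrite ltW.
have [vf _ _] := vP.
move=> i; split=> [j|].
  by apply: sumr_ge0 => s _; rewrite mulr_ge0 // (vf i s).1.
rewrite /trans_prob exchange_big /=.
under eq_bigr do rewrite -mulr_sumr (vf i _).2 mulr1.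
by case: th {s0}.
Qed.

Let K_ge0 th i j : 0 <= K th i j. Proof. exact: (trans_stochastic th i).1. Qed.

Section Recurrence.
Variable th : bool.
Local Notation taboo := (taboo piH piL P th).

Lemma taboo_ge0 i t j : 0 <= taboo i t j.
Proof.
elim: t j => [|t IH] j /=; first exact: ler0n.
case: eqP => // _; apply: sumr_ge0 => k _; exact: mulr_ge0.
Qed.

Lemma taboo_mass i t : \sum_j taboo i t.+1 j =
  \sum_j taboo i t j - \sum_k taboo i t k * K th k i.
Proof.
apply/eqP; rewrite -subr_eq opprK eq_sym; apply/eqP.
under eq_bigr => k _ do rewrite -[taboo i t k]mulr1 -(trans_stochastic th k).2 mulr_sumr.
rewrite exchange_big /= (bigD1 i) //= addrC; congr (_ + _).
rewrite [RHS](bigD1 i) //= eqxx add0r; apply: eq_bigr => j /negPf -> //.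
Qed.

(** The taboo chain stays in [C], and weighting its mass by the expected exit time [w] gives a
    Lyapunov function, so the mass vanishes. By [taboo_mass] all of it is lost through returns to
    [i]. *)
Lemma closed_recurrent (C : pred 'I_m) i : C i ->
  (forall j k, C j -> ~~ C k -> K th j k = 0) ->
  reaches (K th) [pred j | (j == i) || ~~ C j] ->
  return_prob piH piL P th i = 1.
Proof.
move=> Ci Cc rK; have [w [wA wK w0]] := exit_time (trans_stochastic th) rK.
have tC t j : ~~ C j -> taboo i t j = 0.
  elim: t j => [|t IH] j Cj /=; first by case: eqP Cj => // ->; rewrite Ci.
  case: eqP => // _; apply: big1 => k _.
  have [Ck|Ck] := boolP (C k); first by rewrite Cc // mulr0.
  by rewrite IH // mul0r.
have T0 : (fun t => \sum_j taboo i t j) @ \oo --> 0.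
  (* The Lyapunov function starts at time 1: at time 0 the mass sits at [i], where [w] is 0. *)
  rewrite -cvg_shiftS.
  apply: (@lyapunov_cvg0 _ _ (fun t => \sum_j taboo i t.+1 j * w j)) => t.
  - by apply: sumr_ge0 => j _; exact: taboo_ge0.
  - by apply: sumr_ge0 => j _; rewrite mulr_ge0 // taboo_ge0.
  transitivity (\sum_k taboo i t.+1 k * \sum_j K th k j * w j).
    under [RHS]eq_bigr do rewrite mulr_sumr.
    rewrite exchange_big /=; apply: eq_bigr => j _ /=.
    have [->|_] := eqVneq j i.
      rewrite wA /= ?eqxx // mul0r big1 // => k _; by rewrite mulrA mulr0.
    by rewrite mulr_suml; apply: eq_bigr => k _; rewrite mulrA.
  rewrite -sumrB; apply: eq_bigr => k _.
  have [kA|kA] := boolP ((k == i) || ~~ C k); last by rewrite wK // mulrBr mulr1.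
  suff -> : taboo i t.+1 k = 0 by rewrite !mul0r subr0.
  by case/orP: kA => [/eqP->|/tC //] /=; rewrite eqxx.
apply: cvg_lim => //.
have -> : (fun n => \sum_(t < n) \sum_k taboo i t k * K th k i) =
    (fun n => 1 - \sum_j taboo i n j).
  apply/funext; elim => [|n IH].
    rewrite big_ord0 (bigD1 i) //= eqxx big1 ?addr0 ?subrr // => j /negPf-> //.
  by rewrite big_ord_recr /= IH taboo_mass; lra.
by rewrite -[X in _ --> X]subr0; apply: cvgB => //; exact: cvg_cst.
Qed.

(** Induction on the size of [C]. If [C] were closed, pick [i] in it: by induction no nonempty
    subset of [C] without [i] is closed, so [i] is reached again from all of [C] and is recurrent,
    against transience. *)
Lemma transient_reaches (A : pred 'I_m) :
  (forall i, ~~ A i -> return_prob piH piL P th i < 1) -> reaches (K th) A.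
Proof.
move=> tr C; have [n] := ubnP #|C|; elim: n C => // n IH C Cn [i Ci] CA.
apply: contrapT => no.
have Cc j k : C j -> ~~ C k -> K th j k = 0.
  move=> Cj Ck; apply/eqP; rewrite eq_le K_ge0 andbT leNgt; apply/negP => Kjk.
  by apply: no; exists j, k.
suff rK : reaches (K th) [pred j | (j == i) || ~~ C j].
  by have := tr i (CA i Ci); rewrite (closed_recurrent Ci Cc rK) ltxx.
move=> C' C'0 C'A; apply: IH => //.
- rewrite ltnS in Cn; apply: leq_trans Cn; apply: proper_card; apply/properP; split.
    apply/fintype.subsetP => j /C'A /=; rewrite negb_or negbK => /andP[] //.
  by exists i => //; apply/negP => /C'A /=; rewrite eqxx.
- by move=> j /C'A /=; rewrite negb_or negbK => /andP[_ /CA].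
Qed.

End Recurrence.
End Protocol.

(** * Payoffs *)

Section Payoffs.
Variables (R : realType) (S : finType) (m : nat) (piH piL : S -> R).
Hypotheses (pH0 : forall s, 0 < piH s) (pL0 : forall s, 0 < piL s).
Hypotheses (pH1 : \sum_s piH s = 1) (pL1 : \sum_s piL s = 1).
Variable P : protocol R S m.
Hypothesis vP : valid_protocol P.
Implicit Types (th : bool) (i j : 'I_m) (sg : strategy R m).

Local Notation K := (trans_prob piH piL P).
Local Notation alive := (alive piH piL P).
Local Notation end_prob := (end_prob piH piL P).

Let sK th : stochastic (K th) := trans_stochastic pH0 pL0 pH1 pL1 vP th.

Section Strategy.
Variables (sg : strategy R m) (th : bool).
Hypothesis vsg : valid_strategy sg.

Lemma stop_prob01 i : 0 <= stop_prob P sg th i <= 1.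
Proof. by rewrite /stop_prob; case: ifP => _; [rewrite ler01 lexx | exact: vsg]. Qed.

Lemma alive_ge0 t i : 0 <= alive sg th t i.
Proof.
elim: t i => [|t IH] i /=; first by case: vP => _ [].
apply: sumr_ge0 => j _; rewrite mulr_ge0 ?(sK th j).1 // mulr_ge0 // subr_ge0.
by case/andP: (stop_prob01 j).
Qed.

Lemma alive_step (f : 'I_m -> R) t : \sum_j alive sg th t.+1 j * f j =
  \sum_i alive sg th t i * (1 - stop_prob P sg th i) * \sum_j K th i j * f j.
Proof.
under [RHS]eq_bigr do rewrite mulr_sumr.
rewrite exchange_big /=; apply: eq_bigr => j _; rewrite mulr_suml.
by apply: eq_bigr => i _; rewrite mulrA.
Qed.

Lemma alive_mass t : \sum_j alive sg th t.+1 j =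
  \sum_i alive sg th t i * (1 - stop_prob P sg th i).
Proof.
under eq_bigr do rewrite -[alive _ _ _ _]mulr1.
rewrite (alive_step (fun=> 1)); apply: eq_bigr => i _.
by under eq_bigr do rewrite mulr1; rewrite (sK th i).2 mulr1.
Qed.

Lemma stopped_mass n :
  \sum_i \sum_(t < n) alive sg th t i * stop_prob P sg th i =
  1 - \sum_i alive sg th n i.
Proof.
rewrite exchange_big /=; elim: n => [|n IH].
  by rewrite big_ord0; case: vP => _ [_ ->] _; rewrite subrr.
rewrite big_ord_recr /= IH alive_mass.
under [in RHS]eq_bigr do rewrite mulrBr mulr1.
rewrite sumrB; lra.
Qed.

Let stopped_ge0 t i : 0 <= alive sg th t i * stop_prob P sg th i.
Proof. by rewrite mulr_ge0 ?alive_ge0 //; case/andP: (stop_prob01 i). Qed.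

Lemma cvg_end_prob i :
  (fun n => \sum_(t < n) alive sg th t i * stop_prob P sg th i) @ \oo
  --> end_prob sg th i.
Proof.
apply: nondecreasing_is_cvgn.
  by apply/nondecreasing_seqP => n; rewrite big_ord_recr /= lerDl.
exists 1 => _ [n _ <-].
apply: (@le_trans _ _ (\sum_i \sum_(t < n) alive sg th t i * stop_prob P sg th i)).
  by rewrite [leRHS](bigD1 i) //= lerDl; apply: sumr_ge0 => j _; apply: sumr_ge0.
by rewrite stopped_mass gerBl; apply: sumr_ge0 => j _; exact: alive_ge0.
Qed.

Lemma cvg_end_total :
  (fun n => 1 - \sum_i alive sg th n i) @ \oo --> \sum_i end_prob sg th i.
Proof.
under eq_fun do rewrite -stopped_mass.
by apply: cvg_big => [|i _]; [exact: add_continuous | exact: cvg_end_prob].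
Qed.

Lemma end_prob_ge0 i : 0 <= end_prob sg th i.
Proof.
apply: limr_ge; first by apply/cvg_ex; eexists; exact: cvg_end_prob.
by apply: nearW => n; apply: sumr_ge0.
Qed.

Lemma end_total_le1 : \sum_i end_prob sg th i <= 1.
Proof.
apply: (cvgr_to_le cvg_end_total).
by apply: nearW => n; rewrite gerBl; apply: sumr_ge0 => i _; exact: alive_ge0.
Qed.

End Strategy.

Lemma UR_le1 (p : R) sg : 0 < p < 1 -> valid_strategy sg -> UR piH piL p P sg <= 1.
Proof.
move=> /andP[p0 p1] vsg.
have le1 th (f : 'I_m -> R) : (forall i, f i <= 1) -> \sum_i end_prob sg th i * f i <= 1.
  move=> f1; apply: le_trans (end_total_le1 th vsg); apply: ler_sum => i _.
  by rewrite ler_piMr // end_prob_ge0.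
have [_ _ va] := vP.
rewrite /UR big_bool /=.
have le_t := @le1 true (pa P) (fun i => proj2 (andP (va i))).
have le_f : \sum_i end_prob sg false i * (1 - pa P i) <= 1.
  by apply: le1 => i; rewrite gerBl; case/andP: (va i).
have := ler_wpM2l (ltW p0) le_t.
have q0 : 0 <= 1 - p by rewrite subr_ge0 ltW.
have := ler_wpM2l q0 le_f.
lra.
Qed.

Lemma UR_val_le1 (p : R) : 0 < p < 1 -> UR_val piH piL p P <= 1.
Proof.
move=> p01; rewrite /UR_val.
(* Without a best response, [UR_val] is the supremum of the empty set, which is 0. *)
have [->|/set0P ne] := eqVneq [set UR piH piL p P sg | sg in br piH piL p P] set0.
  by rewrite sup0 ler01.
apply: sup_le_ub => // _ [sg [vsg _] <-]; exact: UR_le1.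
Qed.

(** * Best responses to protocols with two absorbing states *)

Section TwoAbsorbing.
Variables (i0 i1 : 'I_m) (h : bool -> 'I_m -> R).
Hypothesis absE : forall i, absorbing P i = pred2 i0 i1 i.
Hypothesis paE : forall i, pa P i = (i == i1)%:R.
Hypothesis rK : forall th, reaches (K th) (pred2 i0 i1).
Hypothesis hh : forall th, hitting i0 i1 (K th) (h th).

Let win th := \sum_i pg P i * h th i.

(** A transition preserves the mean of the harmonic function [h], so its total over continuing play
    falls exactly by what stopping removes. *)
Lemma alive_hit sg th t : \sum_j alive sg th t.+1 j * h th j =
  \sum_i alive sg th t i * h th i
  - \sum_i alive sg th t i * stop_prob P sg th i * h th i.
Proof.
rewrite alive_step -sumrB; apply: eq_bigr => i _.
have [iA|iA] := boolP (absorbing P i).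
  by rewrite /stop_prob iA subrr mulr1 mulr0 mul0r subrr.
case: (hh th) => _ _ <-; last by rewrite -absE.
by rewrite mulrBr mulr1 mulrBl.
Qed.

(** Optional stopping: the mass already ended at [i1] plus the mean of [h] over play still alive
    never exceeds its initial value. *)
Lemma end_prob_hit_le sg th : valid_strategy sg -> end_prob sg th i1 <= win th.
Proof.
move=> vsg; apply: limr_le; first by apply/cvg_ex; eexists; exact: cvg_end_prob.
have h0 := hitting_ge0 (sK th) (rK th) (hh th).
have h1 : h th i1 = 1 by case: (hh th).
apply: nearW => n.
suff : \sum_(t < n) alive sg th t i1 * stop_prob P sg th i1 +
    \sum_j alive sg th n j * h th j <= win th.
  apply: le_trans; rewrite lerDl; apply: sumr_ge0 => j _.
  by rewrite mulr_ge0 ?alive_ge0.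
elim: n => [|n]; first by rewrite big_ord0 add0r.
apply: le_trans; rewrite big_ord_recr /= alive_hit -addrA lerD2l addrCA gerDl subr_le0.
rewrite [leRHS](bigD1 i1) //= h1 mulr1 lerDl; apply: sumr_ge0 => j _.
by rewrite mulr_ge0 // mulr_ge0 ?alive_ge0 //; case/andP: (stop_prob01 th vsg j).
Qed.

(** [stop_prob] is 1 in absorbing states whatever the strategy, so under this one the game ends
    exactly at absorption. *)
Definition never : strategy R m := fun _ _ => 0.

Lemma valid_never : valid_strategy never.
Proof. by move=> i th; rewrite lexx ler01. Qed.

Lemma stop_never th i : stop_prob P never th i = (pred2 i0 i1 i)%:R.
Proof. by rewrite /stop_prob absE; case: (pred2 _ _ _). Qed.

Lemma alive_never_cvg0 th : (fun n => \sum_i alive never th n i) @ \oo --> 0.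
Proof.
have [w [wA wK w0]] := exit_time (sK th) (rK th).
rewrite -cvg_shiftS.
apply: (@lyapunov_cvg0 _ _ (fun t => \sum_j alive never th t j * w j)) => t.
- by apply: sumr_ge0 => j _; rewrite (alive_ge0 _ valid_never).
- by apply: sumr_ge0 => j _; rewrite mulr_ge0 // (alive_ge0 _ valid_never).
rewrite -[X in _ = _ - X]/(\sum_i alive never th t.+1 i) alive_step alive_mass.
rewrite -sumrB; apply: eq_bigr => i _; rewrite stop_never.
have [iA|iA] := boolP (pred2 i0 i1 i).
  by rewrite subrr mulr0 mul0r wA // mulr0 subrr.
by rewrite subr0 mulr1 wK // mulrBr mulr1.
Qed.

(** The balance of [alive_hit] loses nothing here: play stops only at [i1], where [h] is 1, or at
    [i0], where [h] is 0, and the part still alive vanishes in the limit. *)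
Lemma end_never th : end_prob never th i1 = win th.
Proof.
apply: cvg_lim => //.
have -> : (fun n => \sum_(t < n) alive never th t i1 * stop_prob P never th i1) =
    (fun n => win th - \sum_j alive never th n j * h th j).
  apply/funext; elim => [|n IH]; first by rewrite big_ord0 subrr.
  rewrite big_ord_recr /= IH alive_hit.
  suff -> : \sum_i alive never th n i * stop_prob P never th i * h th i =
      alive never th n i1 * stop_prob P never th i1 by lra.
  case: (hh th) => h0 h1 _.
  rewrite (bigD1 i1) //= h1 mulr1 big1 ?addr0 // => j /negPf ji1.
  rewrite stop_never /= ji1 orbF; have [->|] := eqVneq j i0.
    by rewrite h0 mulr0.
  by rewrite mulr0 mul0r.
rewrite -[X in _ --> X]subr0; apply: cvgB; first exact: cvg_cst.
apply: (squeeze_cvgr _ (cvg_cst 0) (alive_never_cvg0 th)).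
have h0 := hitting_ge0 (sK th) (rK th) (hh th).
have h1 := hitting_le1 (sK th) (rK th) (hh th).
apply: nearW => n; apply/andP; split.
  by apply: sumr_ge0 => j _; rewrite mulr_ge0 // (alive_ge0 _ valid_never).
by apply: ler_sum => j _; rewrite ler_piMr // (alive_ge0 _ valid_never).
Qed.

Lemma end_never_total th : \sum_i end_prob never th i = 1.
Proof.
have c1 := cvg_end_total (th := th) valid_never.
have c2 : (fun n => 1 - \sum_i alive never th n i) @ \oo --> (1 : R).
  by rewrite -[X in _ --> X]subr0; apply: cvgB; [exact: cvg_cst | exact: alive_never_cvg0].
exact: (cvg_unique _ c1 c2).
Qed.

Variable p : R.
Hypothesis p01 : 0 < p < 1.

Lemma US_E sg : US piH piL p P sg =
  p * end_prob sg true i1 + (1 - p) * end_prob sg false i1.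
Proof.
rewrite /US big_bool /=; congr (_ * _ + _ * _);
  rewrite (bigD1 i1) //= paE eqxx mulr1 big1 ?addr0 // => i /negPf ii1;
  by rewrite paE ii1 mulr0.
Qed.

Lemma UR_E sg : UR piH piL p P sg = p * end_prob sg true i1 +
  (1 - p) * (\sum_i end_prob sg false i - end_prob sg false i1).
Proof.
rewrite /UR big_bool /=; congr (_ * _ + _ * _); rewrite [LHS](bigD1 i1) //=.
  rewrite paE eqxx mulr1 big1 ?addr0 // => i /negPf ii1.
  by rewrite paE ii1 mulr0.
rewrite paE eqxx subrr mulr0 add0r [X in _ = X - _](bigD1 i1) //= addrAC subrr add0r.
by apply: eq_bigr => i /negPf ii1; rewrite paE ii1 subr0 mulr1.
Qed.

Lemma sup_max (E : set R) x : E x -> (forall y, E y -> y <= x) -> sup E = x.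
Proof.
move=> Ex xub; apply/eqP; rewrite eq_le; apply/andP; split.
  by apply: sup_le_ub => //; exists x.
by apply: ub_le_sup => //; exists x.
Qed.

Lemma US_val_two_absorbing :
  US_val piH piL p P = p * win true + (1 - p) * win false.
Proof.
case/andP: p01 => p0 p1.
apply: sup_max.
  by exists never; [exact: valid_never | rewrite US_E !end_never].
move=> _ [sg vsg <-]; rewrite US_E.
by apply: lerD; rewrite ler_wpM2l ?subr_ge0 ?(ltW p0) ?(ltW p1) // end_prob_hit_le.
Qed.

(* A best response must maximise the probability of absorption at [i1] in each
   state of nature separately. *)
Lemma UR_val_two_absorbing :
  UR_val piH piL p P = p * win true + (1 - p) * (1 - win false).
Proof.
case/andP: p01 => p0 p1; have q0 : 0 < 1 - p by rewrite subr_gt0.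
apply: sup_max.
  exists never; last by rewrite UR_E !end_never end_never_total.
  by split; [exact: valid_never | rewrite US_val_two_absorbing US_E !end_never].
move=> _ [sg [vsg E] <-]; move: E; rewrite US_val_two_absorbing US_E => E; rewrite UR_E.
have Ht := ler_wpM2l (ltW p0) (end_prob_hit_le true vsg).
have Hf := ler_wpM2l (ltW q0) (end_prob_hit_le false vsg).
have := ler_wpM2l (ltW q0) (end_total_le1 false vsg).
rewrite !mulrBr; lra.
Qed.

End TwoAbsorbing.
End Payoffs.

Lemma inf_min (R : realType) (E : set R) x : E x -> (forall y, E y -> x <= y) -> inf E = x.
Proof.
move=> Ex xlb; apply/eqP; rewrite eq_le; apply/andP; split.
  by apply: ge_inf => //; exists x.
by apply: lb_le_inf => //; exists x.
Qed.

(** * Likelihood ratios and the odds bound for parsimonious protocols *)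

Section Signals.
Variables (R : realType) (S : finType) (piH piL : S -> R).
Hypotheses (pH0 : forall s, 0 < piH s) (pL0 : forall s, 0 < piL s).
Hypotheses (pH1 : \sum_s piH s = 1) (pL1 : \sum_s piL s = 1).

Lemma signal_inhabited : exists s : S, True.
Proof.
apply: contrapT => no; have /eqP := pH1; rewrite big1 ?(eq_sym 0) ?oner_eq0 // => s.
by case: no; exists s.
Qed.

(** The maximising signal will drive the upward moves of the ladder; the bound without division can
    be summed over signals. *)
Lemma lbarP : exists s, lbar piH piL = piH s / piL s /\
  forall t, piH t <= lbar piH piL * piL t.
Proof.
have [s0 _] := signal_inhabited.
pose s := [arg max_(s > s0) (piH s / piL s)]%O.
have sP t : piH t / piL t <= piH s / piL s.
  by rewrite /s; case: arg_maxP => // i _; apply.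
have lE : lbar piH piL = piH s / piL s.
  by apply: sup_max; [exists s | move=> _ [t _ <-]].
by exists s; split => // t; rewrite -ler_pdivrMr // lE.
Qed.

Lemma lunderP : exists s, lunder piH piL = piH s / piL s /\
  forall t, lunder piH piL * piL t <= piH t.
Proof.
have [s0 _] := signal_inhabited.
pose s := [arg min_(s < s0) (piH s / piL s)]%O.
have sP t : piH s / piL s <= piH t / piL t.
  by rewrite /s; case: arg_minP => // i _; apply.
have lE : lunder piH piL = piH s / piL s.
  by apply: inf_min; [exists s | move=> _ [t _ <-]].
by exists s; split => // t; rewrite -ler_pdivlMr // lE.
Qed.

Lemma lunder_gt0 : 0 < lunder piH piL.
Proof. by have [s [-> _]] := lunderP; rewrite divr_gt0. Qed.

Lemma lbar_ge1 : 1 <= lbar piH piL.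
Proof.
have [_ [_ l]] := lbarP.
by rewrite -[leRHS]mulr1 -{2}pL1 mulr_sumr -pH1; apply: ler_sum.
Qed.

Lemma lunder_le1 : lunder piH piL <= 1.
Proof.
have [_ [_ l]] := lunderP.
by rewrite -[leLHS]mulr1 -{1}pL1 mulr_sumr -pH1; apply: ler_sum.
Qed.

Lemma gamma_ge1 : 1 <= gamma piH piL.
Proof.
by rewrite ler_pdivlMr ?lunder_gt0 // mul1r (le_trans lunder_le1 lbar_ge1).
Qed.

Section Parsimonious.
Variables (m : nat) (P : protocol R S m) (p : R).
Hypotheses (p01 : 0 < p < 1) (vP : valid_protocol P).

(** [x] and [y] are the probabilities of absorption at [i1] under H and L. The likelihood bounds
    pass from signals to transition probabilities, so [odds_change] applies with [lunder] and
    [lbar]. *)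
Lemma parsimonious_payoffs : parsimonious piH piL P -> exists x y,
  [/\ 0 <= x <= 1, 0 <= y <= 1,
      x * (1 - y) <= gamma piH piL ^+ (m - 2) * (1 - x) * y,
      US_val piH piL p P = p * x + (1 - p) * y
    & UR_val piH piL p P = p * x + (1 - p) * (1 - y)].
Proof.
move=> [i0 [i1 [i01 /andP[a0 a1] [pa0 pa1] abs tr]]].
have absE i : absorbing P i = pred2 i0 i1 i.
  apply/idP/idP => [/abs[] ->|/orP[] /eqP -> //] /=.
    by rewrite eqxx.
  by rewrite eqxx orbT.
have paE i : pa P i = (i == i1)%:R.
  have [->//|ii1] := eqVneq i i1; have [->//|ii0] := eqVneq i i0.
  by case: (tr i ii0 ii1).
have sK th := trans_stochastic pH0 pL0 pH1 pL1 vP th.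
have rK th : reaches (trans_prob piH piL P th) (pred2 i0 i1).
  apply: (transient_reaches pH0 pL0 pH1 pL1 vP) => i /=.
  by rewrite negb_or => /andP[ii0 ii1]; have [+ _] := tr i ii0 ii1; apply.
have [hH hhH] := hitting_exists i01 (sK true) (rK true).
have [hL hhL] := hitting_exists i01 (sK false) (rK false).
pose h th := if th then hH else hL.
have hh th : hitting i0 i1 (trans_prob piH piL P th) (h th) by case: th.
have [vf dg _] := vP.
exists (\sum_i pg P i * hH i), (\sum_i pg P i * hL i).
rewrite (US_val_two_absorbing pH0 pL0 pH1 pL1 vP absE paE rK hh p01).
rewrite (UR_val_two_absorbing pH0 pL0 pH1 pL1 vP absE paE rK hh p01).
split => //.
- rewrite (distr_ge0 dg (hitting_ge0 (sK true) (rK true) hhH)).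
  by rewrite (distr_le1 dg (hitting_le1 (sK true) (rK true) hhH)).
- rewrite (distr_ge0 dg (hitting_ge0 (sK false) (rK false) hhL)).
  by rewrite (distr_le1 dg (hitting_le1 (sK false) (rK false) hhL)).
have [_ [_ lo]] := lunderP; have [_ [_ hi]] := lbarP.
have lo0 := lunder_gt0.
have lohi i j : lunder piH piL * trans_prob piH piL P false i j <=
    trans_prob piH piL P true i j <= lbar piH piL * trans_prob piH piL P false i j.
  rewrite /trans_prob !mulr_sumr; apply/andP; split; apply: ler_sum => s _ /=;
    by rewrite mulrA ler_wpM2r // (vf i s).1.
have := odds_change i01 dg (sK false) (sK true) (rK false) hhL hhH lo0 lohi.
set n := (m - 2)%N; set x := \sum_i _ * hH _; set y := \sum_i _ * hL _ => H.
rewrite -(ler_pM2l (exprn_gt0 n lo0)) mulrA; apply: le_trans H _.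
by rewrite !mulrA /gamma expr_div_n [_ * (_ / _)]mulrC divfK ?gt_eqF ?exprn_gt0.
Qed.

Lemma UR_val_le_sup : UR_val piH piL p P <= UR_sup m piH piL p.
Proof.
apply: ub_le_sup; last by exists P.
exists 1 => _ [Q vQ <-]; exact: UR_val_le1.
Qed.

End Parsimonious.

(** * Protocols that either stay put or jump to a prescribed target *)

Section Jump.
Variables (m : nat) (i0 i1 start : 'I_m) (r : 'I_m -> S -> R) (tgt : 'I_m -> S -> 'I_m).

Definition jump_protocol : protocol R S m := {|
  pf i s j := (1 - r i s) * (j == i)%:R + r i s * (j == tgt i s)%:R;
  pg i := (i == start)%:R;
  pa i := (i == i1)%:R |}.

Lemma sum_indicator (T : finType) (i : T) (f : T -> R) : \sum_j (j == i)%:R * f j = f i.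
Proof.
rewrite (bigD1 i) //= eqxx mul1r big1 ?addr0 // => j /negPf->.
by rewrite mul0r.
Qed.

Hypothesis r01 : forall i s, 0 <= r i s <= 1.
Hypothesis r_abs : forall i s, pred2 i0 i1 i -> r i s = 0.
Hypothesis r_exit : forall C : pred 'I_m, (exists i, C i) ->
  (forall i, C i -> ~~ pred2 i0 i1 i) ->
  exists i s, [/\ C i, ~~ C (tgt i s) & 0 < r i s].

Lemma jump_valid : valid_protocol jump_protocol.
Proof.
split=> [i s||i]; [split=> [j|]|split=> [j|]|]; rewrite ?ler0n //=.
- by case/andP: (r01 i s) => r0 r1; rewrite addr_ge0 // mulr_ge0 ?subr_ge0 ?ler0n.
- rewrite big_split /= -!mulr_sumr.
  under eq_bigr do rewrite -[(_ == i)%:R]mulr1.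
  under [X in _ + _ * X]eq_bigr do rewrite -[(_ == _)%:R]mulr1.
  by rewrite !(sum_indicator _ (fun=> 1)) !mulr1 subrK.
- under eq_bigr do rewrite -[(_ == _)%:R]mulr1.
  by rewrite (sum_indicator _ (fun=> 1)).
- by rewrite lern1 leq_b1.
Qed.

Lemma jump_trans th i (f : 'I_m -> R) :
  \sum_j trans_prob piH piL jump_protocol th i j * f j =
  f i + \sum_s sigprob piH piL th s * (r i s * (f (tgt i s) - f i)).
Proof.
have s1 : \sum_s sigprob piH piL th s = 1 by case: th.
transitivity (\sum_s sigprob piH piL th s * f i +
    \sum_s sigprob piH piL th s * (r i s * (f (tgt i s) - f i))); last first.
  by rewrite -mulr_suml s1 mul1r.
under eq_bigr do rewrite mulr_suml.
rewrite exchange_big /= -big_split /=; apply: eq_bigr => s _.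
under eq_bigr do rewrite -mulrA /= mulrDl -!mulrA.
rewrite -mulr_sumr big_split /= -!mulr_sumr !sum_indicator; ring.
Qed.

(** Any explicit solution [h] of the increment equations with the right boundary values is the
    absorption probability, so the payoff can be read off at [start]. *)
Lemma jump_UR_val (p : R) (h : bool -> 'I_m -> R) : 0 < p < 1 ->
  (forall th, h th i0 = 0) -> (forall th, h th i1 = 1) ->
  (forall th i, ~~ pred2 i0 i1 i ->
    \sum_s sigprob piH piL th s * (r i s * (h th (tgt i s) - h th i)) = 0) ->
  UR_val piH piL p jump_protocol = p * h true start + (1 - p) * (1 - h false start).
Proof.
move=> p01 h0 h1 hE; have vP := jump_valid.
have absE i : absorbing jump_protocol i = pred2 i0 i1 i.
  apply/idP/idP => [/forallP abs|iA].
    (* Applied to a singleton, [r_exit] shows that no further state is absorbing. *)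
    apply: contraT => iA; have [|j /eqP->//|j [s [/eqP -> /negPf tj rj]]] :=
      r_exit (C := pred1 i); first by exists i => /=.
    have := abs s; move: tj; rewrite /= eqxx mulr1 eq_sym => ->.
    by rewrite mulr0 addr0 => /eqP; lra.
  by apply/forallP => s; rewrite /= r_abs // eqxx subr0 mulr1 mul0r addr0.
have s0 th s : 0 < sigprob piH piL th s by case: th => /=.
have rK th : reaches (trans_prob piH piL jump_protocol th) (pred2 i0 i1).
  move=> C C0 CA; have [i [s [Ci Ct rs]]] := r_exit C0 CA.
  exists i, (tgt i s); split=> //; rewrite /trans_prob (bigD1 s) //= ltr_wpDr //.
    apply: sumr_ge0 => s' _; rewrite mulr_ge0 ?(ltW (s0 _ _)) //.
    by have [vf _ _] := vP; apply: (vf i s').1.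
  rewrite mulr_gt0 // eqxx mulr1 ltr_wpDl // mulr_ge0 ?ler0n ?subr_ge0 //.
  by case/andP: (r01 i s).
have hh th : hitting i0 i1 (trans_prob piH piL jump_protocol th) (h th).
  by split=> // i iA; rewrite jump_trans hE // addr0.
rewrite (UR_val_two_absorbing pH0 pL0 pH1 pL1 vP absE (fun=> erefl) rK hh p01) /=.
by rewrite !sum_indicator.
Qed.

End Jump.
End Signals.

(** * Asymptotically optimal protocols *)

Section LowerBound.
Variables (R : realType) (S : finType) (piH piL : S -> R).
Hypotheses (pH0 : forall s, 0 < piH s) (pL0 : forall s, 0 < piL s).
Hypotheses (pH1 : \sum_s piH s = 1) (pL1 : \sum_s piL s = 1).
Variable p : R.
Hypothesis p01 : 0 < p < 1.

(** Starting in an absorbing state makes the receiver act on the prior alone: the top earns [p], the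
    bottom [1 - p]. *)
Lemma UR_sup_ge_prior n :
  p <= UR_sup n.+2 piH piL p /\ 1 - p <= UR_sup n.+2 piH piL p.
Proof.
pose i0 : 'I_n.+2 := ord0; pose i1 : 'I_n.+2 := ord_max.
have [s _] := signal_inhabited pH1.
pose r (i : 'I_n.+2) (s : S) : R := (~~ pred2 i0 i1 i)%:R.
pose tgt (i : 'I_n.+2) (s : S) := i0.
pose h (th : bool) i : R := (i == i1)%:R.
have i01 : i0 != i1 by [].
have r01 i t : 0 <= r i t <= 1 by rewrite ler0n lern1 leq_b1.
have r_abs i t : pred2 i0 i1 i -> r i t = 0 by rewrite /r => ->.
have r_exit (C : pred 'I_n.+2) : (exists i, C i) ->
    (forall i, C i -> ~~ pred2 i0 i1 i) ->
    exists i t, [/\ C i, ~~ C (tgt i t) & 0 < r i t].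
  move=> [i Ci] CA; exists i, s; split=> //; last by rewrite /r CA // ltr01.
  by apply/negP => /CA.
have UE start := jump_UR_val pH0 pL0 pH1 pL1 start r01 r_abs r_exit (h := h) p01.
have le start : p * h true start + (1 - p) * (1 - h false start) <= UR_sup n.+2 piH piL p.
  rewrite -UE => [|th|th|th i iA].
  - by apply: UR_val_le_sup => //; exact: jump_valid.
  - by rewrite /h (negPf i01).
  - by rewrite /h eqxx.
  - apply: big1 => t _; rewrite /h /tgt (negPf i01).
    by move: iA => /=; rewrite negb_or => /andP[_ /negPf ->]; rewrite subr0 !mulr0.
split; [have := le i1 | have := le i0]; rewrite /h ?eqxx ?(negPf i01) /= ?mulr1n ?mulr0n; lra.
Qed.

(** * The ladder protocol and its absorption probabilities *)

Section Ladder.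
Variables (n : nat) (s0 s1 : S) (delta c : R).
Hypotheses (s10 : s1 != s0) (delta01 : 0 < delta <= 1) (c0 : 0 < c).

Let bot : 'I_n.+3 := ord0.
Let top : 'I_n.+3 := ord_max.
(** A common factor for both moves out of state 1: it keeps their probabilities at most 1 without
    affecting the odds. *)
Let tau := (1 + c)^-1.
Let up (i : 'I_n.+3) := if val i == 1%N then tau else delta.
Let dn (i : 'I_n.+3) := if val i == 1%N then tau * (c * delta ^+ n) else 1.
Let r (i : 'I_n.+3) (s : S) :=
  if pred2 bot top i then 0 else if s == s1 then up i else if s == s0 then dn i else 0.
Let tgt (i : 'I_n.+3) (s : S) : 'I_n.+3 :=
  if s == s1 then inord i.+1 else if val i == 1%N then bot else inord 1.

Let k th := sigprob piH piL th s1 / sigprob piH piL th s0.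
Let rho th := (1 + delta * k th)^-1.
(* Odds of absorption at the top from state 1; [k] is the ratio of the probabilities
   of the signals moving up and down. *)
Definition ladder_odds th := k th ^+ n.+1 / c * rho th ^+ n.
Let h1 th := ladder_odds th / (1 + ladder_odds th).
(** From a state above 1, [q] is the probability that the next move is upward and not a reset. In
    [h], the power of [q] is thus the probability of reaching the top without a reset; after a reset
    the value is [h1]. *)
Let q th := delta * k th * rho th.
Let h th (i : 'I_n.+3) := if val i == 0%N then 0
  else if val i == 1%N then h1 th else h1 th + q th ^+ (n.+2 - i) * (1 - h1 th).

Let sg0 th s : 0 < sigprob piH piL th s. Proof. by case: th => /=. Qed.
Let k0 th : 0 < k th. Proof. by rewrite divr_gt0. Qed.
Let d0 : 0 < delta. Proof. by case/andP: delta01. Qed.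
Let dk0 th : 0 < 1 + delta * k th. Proof. by rewrite addr_gt0 // mulr_gt0. Qed.
Let rho0 th : 0 < rho th. Proof. by rewrite invr_gt0. Qed.
Let o0 th : 0 < ladder_odds th.
Proof. by rewrite mulr_gt0 ?divr_gt0 ?exprn_gt0. Qed.
Let tau0 : 0 < tau. Proof. by rewrite invr_gt0 addr_gt0. Qed.

Let up0 i : 0 < up i <= 1.
Proof.
rewrite /up; case: eqP => // _; rewrite tau0 /= invf_le1 ?addr_gt0 //.
by rewrite lerDl ltW.
Qed.

Let dn0 i : 0 < dn i <= 1.
Proof.
rewrite /dn; case: eqP => [_|_]; last by rewrite ltr01 lexx.
have dn1 : delta ^+ n <= 1 by apply: exprn_ile1; case/andP: delta01 => // /ltW.
rewrite !mulr_gt0 ?exprn_gt0 //= mulrC ler_pdivrMr ?addr_gt0 // mul1r.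
by rewrite (@le_trans _ _ c) ?ler_piMr ?(ltW c0) // lerDr ler01.
Qed.

Lemma UR_sup_ge_ladder :
  p * h1 true + (1 - p) * (1 - h1 false) <= UR_sup n.+3 piH piL p.
Proof.
have i01 : bot != top by [].
have r01 i s : 0 <= r i s <= 1.
  rewrite /r; case: ifP => _; first by rewrite lexx ler01.
  have /andP[/ltW u0 u1] := up0 i; have /andP[/ltW e0 e1] := dn0 i.
  by do 2 (case: ifP => _; first by apply/andP); rewrite lexx ler01.
have r_abs i s : pred2 bot top i -> r i s = 0 by rewrite /r => ->.
have mid (i : 'I_n.+3) : ~~ pred2 bot top i -> (0 < i)%N /\ (i < n.+2)%N.
  rewrite /= negb_or -!val_eqE /= => /andP[i_n0 i_top].
  by have := ltn_ord i; lia.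
have r_exit (C : pred 'I_n.+3) : (exists i, C i) ->
    (forall i, C i -> ~~ pred2 bot top i) ->
    exists i s, [/\ C i, ~~ C (tgt i s) & 0 < r i s].
  (* The highest state of [C] leaves [C] by its upward move. *)
  move=> [j Cj] CA; pose i := [arg max_(i > j | C i) val i]%N.
  have [Ci imax] : C i /\ forall i', C i' -> (i' <= i)%N.
    by rewrite /i; case: arg_maxnP => //= i' Ci' l.
  exists i, s1; split=> //.
    apply/negP => /imax; rewrite /tgt eqxx; have [_ il] := mid i (CA i Ci).
    by rewrite inordK ?ltnn.
  by rewrite /r (negPf (CA i Ci)) eqxx; case/andP: (up0 i).
pose start : 'I_n.+3 := inord 1.
have startE : val start = 1%N by rewrite /start /= inordK.
have hst th : h th start = h1 th by rewrite /h startE.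
have UE := jump_UR_val pH0 pL0 pH1 pL1 start r01 r_abs r_exit (h := h) p01.
rewrite -(hst true) -(hst false) -UE => [|th|th|th i iA].
- by apply: UR_val_le_sup => //; exact: jump_valid.
- by [].
- by rewrite /h /= subnn expr0 mul1r addrC subrK.
rewrite (bigD1 s1) //= (bigD1 s0) /=; last by rewrite eq_sym.
rewrite big1 ?addr0 => [|s /andP[/negPf ss1 /negPf ss0]]; last first.
  by rewrite /r ss1 ss0; case: ifP => _; rewrite mul0r mulr0.
rewrite /r (negPf iA) eqxx eq_sym (negPf s10) /tgt !eqxx.
rewrite [s0 == s1]eq_sym (negPf s10).
have [i_gt0 i_lt] := mid i iA.
set u := sigprob _ _ th s1; set d := sigprob _ _ th s0.
have uE : u = k th * d by rewrite /k divfK // gt_eqF.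
have hup : h th (inord i.+1) = h1 th + q th ^+ (n.+1 - i) * (1 - h1 th).
  by rewrite /h /= inordK // subSS eqSS [i == 0%N :> nat]gtn_eqF.
have o1 : 1 + ladder_odds th != 0 by rewrite gt_eqF // addr_gt0.
have h1c : 1 - h1 th = (1 + ladder_odds th)^-1.
  by rewrite /h1 -[X in X - _](divff o1) -mulrBl addrK mul1r.
(* State 1 balances a climb through the [n] states above it against a fall to the bottom, and the
   factors [delta ^+ n] cancel. Higher states balance one step up against a reset. *)
rewrite hup uE /up /dn; case: (eqVneq (val i) 1%N) => [i1|i1].
  have -> : h th i = h1 th by rewrite /h i1.
  have -> : h th bot = 0 by [].
  rewrite i1 subSS subn0 addrAC subrr add0r sub0r h1c /h1 /q.
  rewrite {2}/ladder_odds [(_ * rho th) ^+ n]exprMn [(delta * _) ^+ n]exprMn [k th ^+ _]exprS.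
  have c_n0 : c != 0 by rewrite gt_eqF.
  by field; apply/andP; split.
have -> : h th (inord 1) = h1 th by rewrite hst.
have -> : h th i = h1 th + q th ^+ (n.+2 - i) * (1 - h1 th).
  by rewrite /h (negPf i1) -[_ == 0%N]negbK -lt0n i_gt0.
rewrite [(n.+2 - i)%N]subSn // exprS.
have qE : q th * (1 + delta * k th) = delta * k th.
  by rewrite /q /rho divfK // gt_eqF.
set z := _ ^+ (n.+1 - i); set e := 1 - h1 th.
transitivity (d * z * e * (delta * k th - q th * (1 + delta * k th))); first by ring.
by rewrite qE subrr mulr0.
Qed.

End Ladder.

Lemma bernoulli (a : R) n : 0 <= a <= 1 -> 1 - n%:R * a <= (1 - a) ^+ n.
Proof.
move=> /andP[a0 a1]; elim: n => [|n IH]; first by rewrite mul0r subr0.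
have b0 : 0 <= 1 - a by rewrite subr_ge0.
have := ler_wpM2l b0 IH; rewrite -exprS; apply: le_trans.
have : 0 <= n%:R * (a * a) by rewrite !mulr_ge0.
rewrite -natr1; nra.
Qed.

(** The constant [c] is tuned so that the limiting odds under H are [x / (1 - x)]; since [k true] is
    [gamma] times [k false], the odds under L then tend to [y / (1 - y)]. *)
Lemma UR_sup_ge_odds m (x y : R) : 1 < gamma piH piL ^+ m ->
  0 < x < 1 -> 0 < y < 1 -> x * (1 - y) = gamma piH piL ^+ m * (1 - x) * y ->
  p * x + (1 - p) * (1 - y) <= UR_sup m.+2 piH piL p.
Proof.
case: m => [|n] gn; first by rewrite expr0 ltxx in gn.
have g1 : 1 < gamma piH piL.
  rewrite lt_neqAle (gamma_ge1 pH0 pL0 pH1 pL1) andbT eq_sym.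
  by apply/eqP => gE; rewrite gE expr1n ltxx in gn.
move=> /andP[x0 x1] /andP[y0 y1] xy.
have [s1 [s1E _]] := lbarP pL0 pH1; have [s0 [s0E _]] := lunderP pL0 pH1.
have s10 : s1 != s0.
  apply/eqP => E; move: g1; rewrite /gamma s1E s0E E divff ?ltxx //.
  by rewrite gt_eqF // divr_gt0.
pose k th := sigprob piH piL th s1 / sigprob piH piL th s0.
have sg0 th s : 0 < sigprob piH piL th s by case: th => /=.
have k0 th : 0 < k th by rewrite divr_gt0.
have kE : k true = gamma piH piL * k false.
  rewrite /k /gamma s1E s0E /=; field.
  by rewrite !gt_eqF.
pose c := k true ^+ n.+1 * (1 - x) / x.
have c0 : 0 < c by rewrite divr_gt0 // mulr_gt0 ?exprn_gt0 ?subr_gt0.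
have BH : k true ^+ n.+1 / c = x / (1 - x).
  rewrite /c; field; rewrite !gt_eqF ?exprn_gt0 ?subr_gt0 //.
have BL : k false ^+ n.+1 / c = y / (1 - y).
  pose G := gamma piH piL ^+ n.+1; pose A := k false ^+ n.+1.
  have G0 : G != 0 by rewrite gt_eqF // exprn_gt0 // (lt_trans _ g1).
  have A0 : A != 0 by rewrite gt_eqF // exprn_gt0.
  have xn0 : x != 0 by rewrite gt_eqF.
  have xn1 : 1 - x != 0 by rewrite gt_eqF // subr_gt0.
  have yn1 : 1 - y != 0 by rewrite gt_eqF // subr_gt0.
  have -> : c = G * A * (1 - x) / x by rewrite /c kE [(gamma _ _ * _) ^+ _]exprMn.
  rewrite -/A; transitivity (x / (G * (1 - x))).
    by field; rewrite G0 A0 xn0 xn1.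
  by apply/eqP; rewrite eqr_div ?mulf_neq0 // xy -/G; apply/eqP; ring.
case/andP: p01 => p0 p1.
(* [delta * N] bounds the loss under H, through the Bernoulli estimate for [rho true ^+ n]. Under L,
   the factor [rho false ^+ n] only lowers the odds of the wrong action. *)
pose N : R := p * x * n%:R * k true.
have N0 : 0 <= N.
  rewrite /N; apply: mulr_ge0 (ltW (k0 _)); apply: mulr_ge0 => //.
  by apply: mulr_ge0; exact: ltW.
suff bound delta : 0 < delta <= 1 -> p * x + (1 - p) * (1 - y) <=
    UR_sup n.+3 piH piL p + delta * N.
  apply/ler_addgt0Pr => e e0.
  (* This choice of [delta] is at most 1 and makes [delta * N] at most [e], even when [N = 0]. *)
  have eN : 0 < e / (e + N) by rewrite divr_gt0 // ltr_wpDr.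
  have eN1 : e / (e + N) <= 1 by rewrite ler_pdivrMr ?mul1r ?lerDl // ltr_wpDr.
  have := bound (e / (e + N)); rewrite eN eN1 => /(_ isT) /le_trans; apply.
  rewrite lerD2l mulrAC ler_pdivrMr ?ltr_wpDr //.
  nra.
move=> d01; have /andP[d0 d1] := d01.
pose rho th := (1 + delta * k th)^-1.
have dk th : 0 < delta * k th by rewrite mulr_gt0.
have rho0 th : 0 < rho th by rewrite invr_gt0 addr_gt0.
have rho1 th : rho th <= 1 by rewrite invf_le1 ?addr_gt0 // lerDl ltW.
have rn1 th : rho th ^+ n <= 1 by rewrite exprn_ile1 // ltW.
have rn0 th : 0 < rho th ^+ n by rewrite exprn_gt0.
have low : 1 - n%:R * (delta * k true) <= rho true ^+ n.
  have le1 : 1 - delta * k true <= rho true.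
    rewrite -[leRHS]mul1r ler_pdivlMr ?addr_gt0 //.
    have := dk true; nra.
  (* When [delta * k true] exceeds 1, the left side is nonpositive unless [n = 0], where both sides
     are 1. *)
  have [a1|a1] := leP (delta * k true) 1.
    apply: le_trans (bernoulli _ _) _; first by rewrite a1 ltW.
    by apply: lerXn2r => //; rewrite ?nnegrE ?subr_ge0 // ltW.
  case: n {gn c c0 BH BL N N0 xy rn1} rn0 => [|n] rn0.
    by rewrite mul0r subr0 expr0.
  apply: le_trans (ltW (rn0 true)); rewrite subr_le0.
  apply: le_trans (ltW a1) _; rewrite ler_peMl ?(ltW (dk _)) //.
  by rewrite ler1n.
have := UR_sup_ge_ladder n s10 d01 c0.
rewrite /ladder_odds -/(k true) -/(k false) BH BL -/(rho true) -/(rho false).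
set oH := x / (1 - x) * _; set oL := y / (1 - y) * _.
have hH : x * rho true ^+ n <= oH / (1 + oH).
  have oH0 : 0 < oH by rewrite mulr_gt0 // divr_gt0 // subr_gt0.
  have oHE : oH * (1 - x) = x * rho true ^+ n.
    by rewrite /oH mulrAC divfK // gt_eqF // subr_gt0.
  rewrite -oHE ler_pdivlMr ?addr_gt0 // -mulrA ler_piMr ?(ltW oH0) //.
  rewrite mulrDr mulr1 [_ * oH]mulrC oHE.
  have := rn1 true; nra.
have hL : oL / (1 + oL) <= y.
  have oL0 : 0 < oL by rewrite mulr_gt0 // divr_gt0 // subr_gt0.
  have oLE : oL * (1 - y) = y * rho false ^+ n.
    by rewrite /oL mulrAC divfK // gt_eqF // subr_gt0.
  rewrite ler_pdivrMr ?addr_gt0 //.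
  have := rn1 false; nra.
move=> U.
have A1 := ler_wpM2l (ltW p0) hH.
have q0 : 0 <= 1 - p by rewrite subr_ge0 ltW.
have A2 := ler_wpM2l q0 hL.
have px : 0 <= p * x by rewrite mulr_ge0 // ltW.
have A3 := ler_wpM2l px low.
rewrite /N; lra.
Qed.

End LowerBound.

(** * The constrained maximum *)

(** In the applications [u] measures the deviation of the sender's payoff and [e] depends on the
    receiver's payoff alone. The equation [l = 0] then also identifies the limiting receiver
    payoff. *)
Lemma cvg0_sqr_le (R : realType) (u e : nat -> R) (l : R) :
  (forall n, u n ^+ 2 <= e n) -> e @ \oo --> l -> l <= 0 -> l = 0 /\ u @ \oo --> 0.
Proof.
move=> ue el l0.
have l_eq0 : l = 0.
  apply/eqP; rewrite eq_le l0 /=; apply: (cvgr_to_ge el).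
  by apply: nearW => n; apply: le_trans (ue n); exact: sqr_ge0.
split=> //; rewrite l_eq0 in el.
apply/cvgr0Pnorm_lt => eps eps0.
have eps2 : 0 < eps ^+ 2 by rewrite exprn_gt0.
have /cvgr0Pnorm_lt /(_ _ eps2) := el.
apply: filterS => n en; rewrite -(@ltr_pXn2r _ 2) ?nnegrE ?(ltW eps0) //.
rewrite -normrX ger0_norm ?sqr_ge0 //.
by apply: le_lt_trans (ue n) _; apply: le_lt_trans en; exact: ler_norm.
Qed.

Section Optimisation.
Variables (R : realType) (p Gam : R).
Hypothesis p01 : 0 < p < 1.

(* With [a = p (1 + (Gam - 1) (1 - x))] and [b = (1 - p) (1 + (Gam - 1) y)] the
   constraint reads [a b >= Gam p (1 - p)], the receiver minimises [a + b], and
   the sender's payoff is affine in [b - a]: this is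
   [(b - a)^2 = (a + b)^2 - 4 a b]. *)
Lemma interior_gap (x y : R) : 1 < Gam ->
  x * (1 - y) <= Gam * (1 - x) * y ->
  (p * x + (1 - p) * y - (p + (2 * p - 1) / (Gam - 1))) ^+ 2 <=
  ((1 + (Gam - 1) * (1 - (p * x + (1 - p) * (1 - y)))) ^+ 2
    - 4 * (Gam * p * (1 - p))) / (Gam - 1) ^+ 2.
Proof.
move=> G1 xy; case/andP: p01 => p0 p1.
have G0 : 0 < Gam - 1 by rewrite subr_gt0.
rewrite ler_pdivlMr ?exprn_gt0 // -exprMn.
have -> : (p * x + (1 - p) * y - (p + (2 * p - 1) / (Gam - 1))) * (Gam - 1) =
    (1 - p) * (1 + (Gam - 1) * y) - p * (1 + (Gam - 1) * (1 - x)).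
  by field; rewrite gt_eqF.
have q0 : 0 < 1 - p by rewrite subr_gt0.
have ab : Gam <= (1 + (Gam - 1) * (1 - x)) * (1 + (Gam - 1) * y).
  have := ler_wpM2l (ltW G0) xy; lra.
have pq0 : 0 < p * (1 - p) by rewrite mulr_gt0.
have := ler_wpM2l (ltW pq0) ab; lra.
Qed.

(** The sum [a + b] under [a b = Gam p (1 - p)] is least at [a = b = s]; solving for [x] and [y]
    gives the witnesses. The two strict bounds on [Gam] place them inside the unit interval. *)
Lemma interior_optimum (s : R) : 1 < Gam -> p < Gam * (1 - p) -> 1 - p < Gam * p ->
  0 <= s -> s * s = Gam * p * (1 - p) ->
  exists x y, [/\ 0 < x < 1, 0 < y < 1, x * (1 - y) = Gam * (1 - x) * y
    & p * x + (1 - p) * (1 - y) = 1 - (2 * s - 1) / (Gam - 1)].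
Proof.
move=> Gam_gt1 Gp Gq s0 s2; case/andP: p01 => p0 p1.
have q0 : 0 < 1 - p by rewrite subr_gt0.
have G0 : 0 < Gam - 1 by rewrite subr_gt0.
have sp : p < s by nra.
have sq : 1 - p < s by nra.
have sGp : s < Gam * p by nra.
have sGq : s < Gam * (1 - p) by nra.
pose X := (s / p - 1) / (Gam - 1); pose y := (s / (1 - p) - 1) / (Gam - 1).
have Xn : p != 0 by rewrite gt_eqF.
have qn : 1 - p != 0 by rewrite gt_eqF.
have Gn : Gam - 1 != 0 by rewrite gt_eqF.
exists (1 - X), y; split.
- rewrite subr_gt0 gtrBl ltr_pdivrMr // mul1r divr_gt0 // ?andbT.
    by rewrite ltrD2r ltr_pdivrMr.
  by rewrite subr_gt0 ltr_pdivlMr // mul1r.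
- rewrite ltr_pdivrMr // mul1r divr_gt0 //=.
    by rewrite ltrD2r ltr_pdivrMr.
  by rewrite subr_gt0 ltr_pdivlMr // mul1r.
- have XE : 1 + (Gam - 1) * X = s / p by rewrite /X mulrC divfK // addrC subrK.
  have yE : 1 + (Gam - 1) * y = s / (1 - p) by rewrite /y mulrC divfK // addrC subrK.
  have Xy : (1 + (Gam - 1) * X) * (1 + (Gam - 1) * y) = Gam.
    by rewrite XE yE mulf_div s2 -mulrA mulfK // mulf_neq0.
  by apply: (mulfI Gn); lra.
- by rewrite /X /y; field; rewrite Gn qn Xn.
Qed.

(** [p * X - q * Y] is the receiver's shortfall from acting on the prior. The bound is quadratic in
    [Y] because at the threshold [q * Gam = p] the constraint controls only the product [X * Y]. *)
Lemma boundary_gap (q X Y : R) : 0 < q < p -> 1 <= Gam -> q * Gam <= p ->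
  0 <= X -> 0 <= Y <= 1 -> (1 - X) * Y <= Gam * X * (1 - Y) ->
  Y ^+ 2 <= Gam * (p * X - q * Y) / (p - q).
Proof.
move=> /andP[q0 qp] G1 qG X0 /andP[Y0 Y1] XY.
rewrite ler_pdivlMr ?subr_gt0 //.
have YX : Y <= Gam * X - (Gam - 1) * (X * Y) by lra.
have XY0 : 0 <= X * Y by rewrite mulr_ge0.
have G0 : 0 <= Gam - 1 by rewrite subr_ge0.
have YGX : Y <= Gam * X.
  by have := mulr_ge0 G0 XY0; lra.
(* Each term is next bounded below by a multiple of [Y ^+ 2]; the coefficients [p - q * Gam] and
   [q * (Gam - 1)] add up to [p - q]. *)
have e1 : (p - q * Gam) * X + q * ((Gam - 1) * (X * Y)) <= p * X - q * Y.
  by have := ler_wpM2l (ltW q0) YX; lra.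
have GG : 0 <= Gam by lra.
have e2 := ler_wpM2l GG e1.
have c0 : 0 <= p - q * Gam by rewrite subr_ge0.
have e3 := ler_wpM2l c0 YGX.
have e4 := ler_wpM2l (mulr_ge0 (ltW q0) G0) (ler_wpM2r Y0 YGX).
have YY : Y * Y <= Y by rewrite ler_piMr.
have e5 := ler_wpM2l c0 YY.
rewrite expr2; lra.
Qed.

End Optimisation.

(** * Convergence of the sender's payoff along optimal sequences *)

Theorem theorem3 (R : realType) (S : finType) (m : nat)
    (piH piL : S -> R) (p : R) (Pi : nat -> protocol R S m) :
  (2 <= m)%N ->
  0 < p < 1 ->
  (forall s, 0 < piH s) -> (forall s, 0 < piL s) ->
  \sum_s piH s = 1 -> \sum_s piL s = 1 -> piH <> piL ->
  (forall n, valid_protocol (Pi n) /\ parsimonious piH piL (Pi n)) ->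
  (fun n => UR_val piH piL p (Pi n)) @ \oo --> UR_sup m piH piL p ->
  ~ (gamma piH piL ^+ (m - 2) <= kappa p /\ p = 1 / 2) ->
  [/\ kappa p < gamma piH piL ^+ (m - 2) ->
        (fun n => US_val piH piL p (Pi n)) @ \oo -->
          p + (2 * p - 1) / (gamma piH piL ^+ (m - 2) - 1),
      gamma piH piL ^+ (m - 2) <= kappa p -> 1 / 2 < p ->
        (fun n => US_val piH piL p (Pi n)) @ \oo --> (1 : R)
    & gamma piH piL ^+ (m - 2) <= kappa p -> p < 1 / 2 ->
        (fun n => US_val piH piL p (Pi n)) @ \oo --> (0 : R)].
Proof.
case: m Pi => [//|[//|m]] Pi _ p01 pH0 pL0 pH1 pL1 _ vPi limV _.
rewrite (_ : (m.+2 - 2)%N = m); last by rewrite !subSS subn0.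
set Gam := gamma piH piL ^+ m; set U := UR_sup _ _ _ _ in limV *.
set V := fun n => UR_val piH piL p (Pi n) in limV *.
set W := fun n => US_val piH piL p (Pi n).
have /andP[p0 p1] := p01; have q0 : 0 < 1 - p by rewrite subr_gt0.
have g1 := gamma_ge1 pH0 pL0 pH1 pL1.
have Gam1 : 1 <= Gam by rewrite exprn_ege1.
have Gam0 : 0 < Gam := lt_le_trans ltr01 Gam1.
have pay n : exists x y, [/\ 0 <= x <= 1, 0 <= y <= 1,
      x * (1 - y) <= Gam * (1 - x) * y,
      W n = p * x + (1 - p) * y & V n = p * x + (1 - p) * (1 - y)].
  have [vP pP] := vPi n.
  have := parsimonious_payoffs pH0 pL0 pH1 pL1 p01 vP pP.
  by rewrite (_ : (m.+2 - 2)%N = m) // !subSS subn0.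
have [Up Uq] := UR_sup_ge_prior pH0 pL0 pH1 pL1 p01 m.
(* As [1 <= Gam], only a ratio of at least 1 in [kappa] can dominate [Gam]; the side of one half
   selects which. *)
have kappaE : Gam <= kappa p -> (1 - p < p -> (1 - p) * Gam <= p) /\
    (p < 1 - p -> p * Gam <= 1 - p).
  rewrite /kappa le_max !ler_pdivlMr //.
  have := ler_wpM2l (ltW p0) Gam1; have := ler_wpM2l (ltW q0) Gam1.
  by move=> h1 h2 /orP[] h3; split => h4; rewrite mulrC //; lra.
split.
- rewrite /kappa gt_max !ltr_pdivrMr // => /andP[Gp Gq].
  have Gam_gt1 : 1 < Gam by nra.
  have U1 : U <= 1.
    by apply: (cvgr_to_le limV); apply: nearW => n; apply: UR_val_le1 => //; case: (vPi n).
  have G0 : 0 < Gam - 1 by rewrite subr_gt0.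
  pose s := Num.sqrt (Gam * p * (1 - p)).
  have s2 : s * s = Gam * p * (1 - p).
    by rewrite -expr2 sqr_sqrtr // !mulr_ge0 // ltW // (lt_trans _ Gam_gt1).
  have s0 : 0 <= s by exact: sqrtr_ge0.
  have VU : 1 - (2 * s - 1) / (Gam - 1) <= U.
    have [x [y [x01 y01 xy <-]]] := interior_optimum p01 Gam_gt1 Gp Gq s0 s2.
    exact: UR_sup_ge_odds.
  pose e n := ((1 + (Gam - 1) * (1 - V n)) ^+ 2 - 4 * (Gam * p * (1 - p))) / (Gam - 1) ^+ 2.
  pose d n := W n - (p + (2 * p - 1) / (Gam - 1)).
  have de n : d n ^+ 2 <= e n.
    by rewrite /d /e; have [x [y [_ _ xy -> ->]]] := pay n; exact: interior_gap.
  have ecvg : e @ \oo -->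
      ((1 + (Gam - 1) * (1 - U)) ^+ 2 - 4 * (Gam * p * (1 - p))) / (Gam - 1) ^+ 2.
    have lin : (fun n => 1 + (Gam - 1) * (1 - V n)) @ \oo --> 1 + (Gam - 1) * (1 - U).
      apply: cvgD; first exact: cvg_cst.
      by apply: cvgMl_tmp; apply: cvgB => //; exact: cvg_cst.
    by apply: cvgMr_tmp; apply: cvgB; [exact: cvgM | exact: cvg_cst].
  (* [VU] says that [U] is at least the constrained maximum, so [1 + (Gam - 1) * (1 - U)] is at most
     [2 * s] and the limit of [e] is nonpositive. *)
  have [] := cvg0_sqr_le de ecvg.
    rewrite ler_pdivrMr ?exprn_gt0 // mul0r subr_le0 -s2.
    have b0 : 0 <= 1 + (Gam - 1) * (1 - U) by rewrite addr_ge0 // mulr_ge0 ?subr_ge0 // ltW.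
    have b1 : 1 + (Gam - 1) * (1 - U) <= 2 * s.
      have : (2 * s - 1) / (Gam - 1) * (Gam - 1) = 2 * s - 1 by rewrite divfK // gt_eqF.
      have := ler_wpM2l (ltW G0) VU; lra.
    rewrite expr2; nra.
  move=> _ d0; have -> : W = (fun n => d n + (p + (2 * p - 1) / (Gam - 1))).
    by apply/funext => n; rewrite /d subrK.
  by rewrite -[X in _ --> X]add0r; apply: cvgD => //; exact: cvg_cst.
- move=> /kappaE[kp _] hp.
  have qp : 1 - p < p by lra.
  pose e n := (4 * (1 - p) ^+ 2 * Gam / (p - (1 - p))) * (p - V n).
  (* This equals [2 * (1 - p) * (1 - y)], so [boundary_gap] bounds its square by a multiple of the
     shortfall [p - V n]. *)
  pose d n := 1 - W n - (p - V n).
  have pq : 0 < p - (1 - p) by lra.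
  have de n : d n ^+ 2 <= e n.
    have [x [y [/andP[x0 x1] /andP[y0 y1] xy WE VE]]] := pay n.
    have := @boundary_gap _ p Gam (1 - p) (1 - x) (1 - y).
    rewrite q0 qp => /(_ isT Gam1 (kp qp)).
    rewrite !subr_ge0 gerBl y0 y1 x1 !subKr => /(_ isT isT xy).
    have q2 : 0 <= 4 * (1 - p) ^+ 2 by rewrite mulr_ge0 // sqr_ge0.
    move=> /(ler_wpM2l q2); rewrite /d /e WE VE.
    by apply: eq_ind; congr (_ <= _); field; rewrite ?gt_eqF.
  have pV : (fun n => p - V n) @ \oo --> p - U by apply: cvgB => //; exact: cvg_cst.
  have C0 : 0 < 4 * (1 - p) ^+ 2 * Gam / (p - (1 - p)).
    by rewrite divr_gt0 // !mulr_gt0 // exprn_gt0.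
  have ecvg : e @ \oo --> (4 * (1 - p) ^+ 2 * Gam / (p - (1 - p))) * (p - U).
    exact: cvgMl_tmp.
  (* The limit is nonpositive because [p <= U]; its vanishing gives [U = p]. *)
  have [|/eqP] := cvg0_sqr_le de ecvg.
    by rewrite pmulr_rle0 // subr_le0.
  rewrite mulf_eq0 gt_eqF //= => /eqP pU d0.
  have -> : W = (fun n => 1 - (d n + (p - V n))).
    by apply/funext => n; rewrite /d subrK subKr.
  rewrite -[X in _ --> X]subr0 -[X in _ --> _ - X]addr0 -{2}pU.
  by apply: cvgB; [exact: cvg_cst | exact: cvgD].
- move=> /kappaE[_ kp] hp.
  have qp : p < 1 - p by lra.
  pose e n := (4 * p ^+ 2 * Gam / ((1 - p) - p)) * ((1 - p) - V n).
  (* The mirror case, with H and L exchanged: this equals [2 * p * x]. *)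
  pose d n := W n - ((1 - p) - V n).
  have pq : 0 < (1 - p) - p by lra.
  have de n : d n ^+ 2 <= e n.
    have [x [y [/andP[x0 x1] /andP[y0 y1] xy WE VE]]] := pay n.
    have := @boundary_gap _ (1 - p) Gam p y x.
    rewrite p0 qp x0 x1 => /(_ isT Gam1 (kp qp) y0 isT).
    have xy' : (1 - y) * x <= Gam * y * (1 - x) by lra.
    have q2 : 0 <= 4 * p ^+ 2 by rewrite mulr_ge0 // sqr_ge0.
    move=> /(_ xy') /(ler_wpM2l q2); rewrite /d /e WE VE.
    by apply: eq_ind; congr (_ <= _); field; rewrite ?gt_eqF.
  have pV : (fun n => (1 - p) - V n) @ \oo --> (1 - p) - U.
    by apply: cvgB => //; exact: cvg_cst.
  have C0 : 0 < 4 * p ^+ 2 * Gam / ((1 - p) - p).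
    by rewrite divr_gt0 // !mulr_gt0 // exprn_gt0.
  have ecvg : e @ \oo --> (4 * p ^+ 2 * Gam / ((1 - p) - p)) * ((1 - p) - U).
    exact: cvgMl_tmp.
  have [|/eqP] := cvg0_sqr_le de ecvg.
    by rewrite pmulr_rle0 // subr_le0.
  rewrite mulf_eq0 gt_eqF //= => /eqP pU d0.
  have -> : W = (fun n => d n + ((1 - p) - V n)).
    by apply/funext => n; rewrite /d subrK.
  by rewrite -[X in _ --> X]addr0 -{2}pU; exact: cvgD.
Qed.
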